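(* Let $\Gamma=\langle \alpha,\beta \mid \alpha^2=\beta^3=1\rangle$ and let $\phi\colon\Gamma\to\mathrm{Homeo}_+(\mathbb{S}^1)$ be a homomorphism. Let $\phi_{\mathcal{O}_{2,3}}\colon\Gamma\to\mathrm{Homeo}_+(\mathbb{S}^1)$ be the Fuchsian action (the action of the modular group by linear fractional transformations on $\mathbb{R}\cup\{\infty\}\simeq\mathbb{S}^1$), and let $\phi_{\mathcal{O}_{2,3}}^{(5)}$ be its (unique) $5$-fold lift. \begin{enumerate} \item If $(\mathrm{rot}(\phi(\alpha)),\mathrm{rot}(\phi(\beta)),\mathrm{rot}(\phi(\alpha\beta)))=\left(\frac12,\frac13,0\right)$ in $(\mathbb{R}/\mathbb{Z})^3$, then $\phi$ belongs to the semi-conjugacy class of $\phi_{\mathcal{O}_{2,3}}$. \item If $(\mathrm{rot}(\phi(\alpha)),\mathrm{rot}(\phi(\beta)),\mathrm{rot}(\phi(\alpha\beta)))=\left(\frac12,\frac23,\frac15\right)$ in $(\mathbb{R}/\mathbb{Z})^3$, then $\phi$ belongs to the semi-conjugacy class of $\phi_{\mathcal{O}_{2,3}}^{(5)}$. \end{enumerate}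
   Context: $\mathbb{S}^1=\mathbb{R}/\mathbb{Z}$; $\mathrm{Homeo}_+(\mathbb{S}^1)$ is the group of orientation-preserving homeomorphisms of $\mathbb{S}^1$ under composition, and $\widetilde{\mathrm{Homeo}}_+(\mathbb{S}^1)$ is the group of lifts of such homeomorphisms to $\mathbb{R}$, i.e. (increasing) homeomorphisms of $\mathbb{R}$ commuting with integral translations. Rotation number: for $\tilde f\in\widetilde{\mathrm{Homeo}}_+(\mathbb{S}^1)$ the translation number is $\widetilde{\mathrm{rot}}(\tilde f)=\lim_{n\to\infty}\frac{\tilde f^n(\tilde x)-\tilde x}{n}\in\mathbb{R}$ (the limit exists and is independent of $\tilde x\in\mathbb{R}$); for $f\in\mathrm{Homeo}_+(\mathbb{S}^1)$, $\mathrm{rot}(f)=\widetilde{\mathrm{rot}}(\tilde f)\bmod\mathbb{Z}\in\mathbb{R}/\mathbb{Z}$ for any lift $\tilde f$ of $f$. Semi-conjugacy class: a map $h\colon\mathbb{S}^1\to\mathbb{S}^1$ is a degree-one monotone map if it admits a lift $\tilde h\colon\mathbb{R}\to\mathbb{R}$ which commutes with integral translations and is nondecreasing. For homomorphisms $\phi_1,\phi_2\colon\Gamma\to\mathrm{Homeo}_+(\mathbb{S}^1)$, $\phi_1$ is semi-conjugate to $\phi_2$ if there is a continuous degree-one monotone map $h$ with $h\circ\phi_1(\gamma)=\phi_2(\gamma)\circ h$ for every $\gamma\in\Gamma$. This relation is not symmetric; the semi-conjugacy class of $\phi$ is its class under the equivalence relation generated by it. Fuchsian action: $\Gamma=\langle\alpha,\beta\mid\alpha^2=\beta^3=1\rangle\cong\mathbb{Z}_2*\mathbb{Z}_3$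 is the orbifold fundamental group of the 2-orbifold $\mathcal{O}_{2,3}$ (a disk with two cone points of orders $2,3$), identified with $\mathrm{PSL}(2,\mathbb{Z})$ via $\alpha=\left[\begin{smallmatrix}0&-1\\1&0\end{smallmatrix}\right]$, $\beta=\left[\begin{smallmatrix}1&1\\-1&0\end{smallmatrix}\right]$. The action $\phi_{\mathcal{O}_{2,3}}$ is the action of $\mathrm{PSL}(2,\mathbb{Z})$ by linear fractional transformations on $\mathbb{R}\cup\{\infty\}$, identified with $\mathbb{S}^1$ by an orientation-preserving homeomorphism ($\mathbb{R}$ being oriented in the increasing direction). Its rotation numbers at $\alpha,\beta,\alpha\beta$ are $\frac12,\frac13,0$. Lifts: for an integer $k\ge2$ let $p_k\colon\mathbb{S}^1\to\mathbb{S}^1$, $x\mapsto kx$, be the $k$-fold covering map. A homomorphism $\phi\colon\Gamma\to\mathrm{Homeo}_+(\mathbb{S}^1)$ is a $k$-fold lift of a homomorphism $\psi\colon\Gamma\to\mathrm{Homeo}_+(\mathbb{S}^1)$ if $p_k\circ\phi(\gamma)=\psi(\gamma)\circ p_k$ for every $\gamma\in\Gamma$. A $k$-fold lift $\phi_{\mathcal{O}_{2,3}}^{(k)}$ of $\phi_{\mathcal{O}_{2,3}}$ exists if and only if $k\equiv\pm1\bmod 6$, and it is unique when it exists. *)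

(* Defs.v *)
From HB Require Import structures.
From Stdlib Require Import Relation_Operators.
From mathcomp Require Import all_boot all_order all_algebra.
From mathcomp Require Import all_classical all_reals all_analysis.
Import numFieldNormedType.Exports.

Set Implicit Arguments.
Unset Strict Implicit.
Unset Printing Implicit Defensive.

Import Order.TTheory GRing.Theory Num.Theory.

Local Open Scope classical_set_scope.
Local Open Scope ring_scope.
Local Open Scope quotient_scope.

Definition integers (R : realType) : {pred R} := fun x => x \is a Num.int.

Fact integers_zmod_closed (R : realType) : zmod_closed (@integers R).
Proof. by split=> [|x y xZ yZ]; [exact: rpred0|exact: rpredB]. Qed.

HB.instance Definition _ (R : realType) :=
  GRing.isZmodClosed.Build R (@integers R) (@integers_zmod_closed R).

Definition circle (R : realType) : Type :=
  quotient_topology (Quotient.quot (@integers R)).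

HB.instance Definition _ (R : realType) := Topological.on (circle R).
HB.instance Definition _ (R : realType) := Quotient.on (circle R).
HB.instance Definition _ (R : realType) := GRing.isZmodule.Build (circle R)
  (@Quotient.addqA R (@integers R)) (@Quotient.addqC R (@integers R))
  (@Quotient.add0q R (@integers R)) (@Quotient.addNq R (@integers R)).

Definition to_circle (R : realType) (x : R) : circle R := \pi_(circle R) x.

Lemma to_circle_continuous (R : realType) : continuous (@to_circle R).
Proof. exact: pi_continuous. Qed.

Lemma to_circleD (R : realType) : {morph @to_circle R : x y / x + y}.
Proof. exact: Quotient.pi_add. Qed.

Lemma to_circle_eq (R : realType) (x y : R) :
  to_circle x = to_circle y <-> x - y \is a Num.int.
Proof.
split=> xy.
  change (x - y \in @integers R); rewrite Quotient.idealrBE.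
  by apply/eqP; exact: xy.
have : x - y \in @integers R by [].
by rewrite Quotient.idealrBE => /eqP; exact.
Qed.

Lemma to_circle_surj (R : realType) (u : circle R) : exists x, to_circle x = u.
Proof. by exists (repr u); exact: reprK. Qed.

Definition homeomorphism (T U : topologicalType) (f : T -> U) : Prop :=
  exists g : U -> T, [/\ continuous f, continuous g, cancel f g & cancel g f].

Definition commutes_with_translations (R : realType) (F : R -> R) : Prop :=
  forall (x : R) (n : int), F (x + n%:~R) = F x + n%:~R.

Definition is_lift (R : realType) (F : R -> R) (f : circle R -> circle R) :
  Prop := forall x, f (to_circle x) = to_circle (F x).

Definition is_homeo_lift (R : realType) (F : R -> R)
    (f : circle R -> circle R) : Prop :=
  [/\ homeomorphism F, {homo F : x y / x < y}, commutes_with_translations F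
    & is_lift F f].

(* Orientation preserving: the map has an increasing lift. The group law below
   is (f * g)(x) = f (g x). *)

Definition orientation_preserving_homeo (R : realType)
    (f : circle R -> circle R) : Prop :=
  homeomorphism f /\ exists F, is_homeo_lift F f.

Record circle_homeo (R : realType) := CircleHomeo {
  circle_homeo_fun :> circle R -> circle R;
  circle_homeoP : orientation_preserving_homeo circle_homeo_fun }.

HB.instance Definition _ (R : realType) := gen_eqMixin (circle_homeo R).
HB.instance Definition _ (R : realType) := gen_choiceMixin (circle_homeo R).

Section CircleHomeoGroup.
Variable R : realType.
Implicit Types f g : circle_homeo R.

Lemma circle_homeo_eq f g : (forall x, f x = g x) -> f = g.
Proof.
case: f g => [f fP] [g gP] /= /funext E; case: _ / E gP => gP.
by congr CircleHomeo; exact: Prop_irrelevance.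
Qed.

Lemma id_homeomorphism (T : topologicalType) : homeomorphism (@idfun T).
Proof. by exists id; split => // x; exact: cvg_id. Qed.

Lemma comp_homeomorphism (T U V : topologicalType) (f : U -> V) (g : T -> U) :
  homeomorphism f -> homeomorphism g -> homeomorphism (f \o g).
Proof.
move=> [f' [fc fc' fK fK']] [g' [gc gc' gK gK']]; exists (g' \o f'); split.
- by move=> x; apply: continuous_comp; [exact: gc|exact: fc].
- by move=> x; apply: continuous_comp; [exact: fc'|exact: gc'].
- exact: can_comp.
- exact: can_comp.
Qed.

Fact id_oph : orientation_preserving_homeo (@idfun (circle R)).
Proof.
split; first exact: id_homeomorphism.
by exists idfun; split => //; exact: id_homeomorphism.
Qed.

Fact comp_oph f g : orientation_preserving_homeo (f \o g).
Proof.
case: f g => [f [hf [F [hF Fm Fz Ff]]]] [g [hg [G [hG Gm Gz Gg]]]] /=.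
split; first exact: comp_homeomorphism.
exists (F \o G); split; first exact: comp_homeomorphism.
- by move=> x y xy; apply: Fm; exact: Gm.
- by move=> x n /=; rewrite Gz Fz.
- by move=> x /=; rewrite Gg Ff.
Qed.

Fact inv_exists f : exists g : circle_homeo R, cancel f g /\ cancel g f.
Proof.
case: f => [f [[g [fc gc fK gK]] [F [[G [Fc Gc FK GK]] Fm Fz Ff]]]] /=.
have gP : orientation_preserving_homeo g.
  split; first by exists f.
  exists G; split; first by exists F.
  - by move=> x y; rewrite -{1}(GK x) -{1}(GK y) (leW_mono (le_mono Fm)).
  - by move=> x n; rewrite -{1}(GK x) -Fz FK.
  - by move=> x; apply: (can_inj fK); rewrite Ff gK GK.
by exists (CircleHomeo gP).
Qed.

Definition homeo_one : circle_homeo R := CircleHomeo id_oph.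
Definition homeo_mul f g : circle_homeo R := CircleHomeo (comp_oph f g).
Definition homeo_inv f : circle_homeo R := sval (cid (inv_exists f)).

Fact homeo_mulA : associative homeo_mul.
Proof. by move=> f g h; exact: circle_homeo_eq. Qed.
Fact homeo_mul1 : left_id homeo_one homeo_mul.
Proof. by move=> f; exact: circle_homeo_eq. Qed.
Fact homeo_mulr1 : right_id homeo_one homeo_mul.
Proof. by move=> f; exact: circle_homeo_eq. Qed.
Fact homeo_mulV : left_inverse homeo_one homeo_inv homeo_mul.
Proof.
move=> f; apply: circle_homeo_eq => x.
by rewrite /homeo_inv /=; case: cid => g [/= fK _]; exact: fK.
Qed.
Fact homeo_mulrV : right_inverse homeo_one homeo_inv homeo_mul.
Proof.
move=> f; apply: circle_homeo_eq => x.
by rewrite /homeo_inv /=; case: cid => g [/= _ gK]; exact: gK.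
Qed.

End CircleHomeoGroup.

HB.instance Definition _ (R : realType) := isGroup.Build (circle_homeo R)
  (@homeo_mulA R) (@homeo_mul1 R) (@homeo_mulr1 R) (@homeo_mulV R)
  (@homeo_mulrV R).

(* The limit does not depend on the base point, here 0. *)
Definition translation_number (R : realType) (F : R -> R) : R :=
  limn (fun n => (iter n F 0 - 0) / n%:R).

Definition homeo_lift (R : realType) (f : circle_homeo R) : R -> R :=
  sval (cid (circle_homeoP f).2).

Lemma homeo_liftP (R : realType) (f : circle_homeo R) :
  is_homeo_lift (homeo_lift f) f.
Proof. exact: svalP (cid (circle_homeoP f).2). Qed.

(* Another lift differs by an integer translation, which changes the
   translation number by an integer. *)
Definition rotation_number (R : realType) (f : circle_homeo R) : circle R :=
  to_circle (translation_number (homeo_lift f)).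

(* The group <alpha, beta | alpha^2 = beta^3 = 1>: words in the letters
    alpha^{+-1}, beta^{+-1}, modulo the congruence generated by the relations.
    A letter is a pair: the generator (alpha is [false], beta is [true]) and
    whether it is inverted. *)

Definition letter := (bool * bool)%type.
Definition word := seq letter.
Definition la : letter := (false, false).
Definition lb : letter := (true, false).
Definition letter_inv (l : letter) : letter := (l.1, ~~ l.2).

Inductive word_eq : word -> word -> Prop :=
| word_eq_refl u : word_eq u u
| word_eq_sym u v : word_eq u v -> word_eq v u
| word_eq_trans u v w : word_eq u v -> word_eq v w -> word_eq u w
| word_eq_cat u u' v v' :
    word_eq u u' -> word_eq v v' -> word_eq (u ++ v) (u' ++ v')
| word_eq_cancel l : word_eq [:: l; letter_inv l] [::]
| word_eq_alpha : word_eq [:: la; la] [::]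
| word_eq_beta : word_eq [:: lb; lb; lb] [::].

Definition word_eqb (u v : word) : bool := `[< word_eq u v >].

Fact word_eqb_equiv : equiv_class_of word_eqb.
Proof.
split=> [u|u v|v u w]; rewrite /word_eqb.
- by apply/asboolP; exact: word_eq_refl.
- by apply/asboolP/asboolP; exact: word_eq_sym.
- move=> /asboolP uv /asboolP vw; apply/asboolP; exact: word_eq_trans vw.
Qed.

Canonical word_equiv := EquivRelPack word_eqb_equiv.
Canonical word_encModRel := defaultEncModRel word_eqb.

Definition Gamma : Type := {eq_quot word_eqb}.
HB.instance Definition _ := Choice.on Gamma.
HB.instance Definition _ := Quotient.on Gamma.

Definition of_word (w : word) : Gamma := \pi_Gamma w.
Definition word_inv (w : word) : word := rev (map letter_inv w).

Lemma of_wordP u v : of_word u = of_word v <-> word_eq u v.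
Proof.
split=> [uv|uv].
  by apply/asboolP/(eqquotP {eq_quot word_eqb} u v); exact: uv.
by apply/(eqquotP {eq_quot word_eqb} u v)/asboolP.
Qed.

Lemma of_word_surj (g : Gamma) : exists w, of_word w = g.
Proof. by exists (repr g); exact: reprK. Qed.

Definition Gamma_one : Gamma := of_word [::].
Definition Gamma_mul (g h : Gamma) : Gamma := of_word (repr g ++ repr h).
Definition Gamma_inv (g : Gamma) : Gamma := of_word (word_inv (repr g)).

Lemma letter_invK : involutive letter_inv.
Proof. by case=> a b; rewrite /letter_inv /= negbK. Qed.

Lemma word_inv_cat u v : word_inv (u ++ v) = word_inv v ++ word_inv u.
Proof. by rewrite /word_inv map_cat rev_cat. Qed.

Lemma word_invK : involutive word_inv.
Proof.
by move=> w; rewrite /word_inv map_rev revK -map_comp map_id_in// => l _;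
  exact: letter_invK.
Qed.

Lemma word_mulV w : word_eq (w ++ word_inv w) [::].
Proof.
elim: w => [|l w IH]; first exact: word_eq_refl.
have -> : (l :: w) ++ word_inv (l :: w) =
    [:: l] ++ ((w ++ word_inv w) ++ [:: letter_inv l]).
  by rewrite /word_inv /= rev_cons -cats1 catA.
apply: word_eq_trans (word_eq_cancel l).
apply: (word_eq_cat (word_eq_refl _)).
exact: (word_eq_cat IH (word_eq_refl [:: letter_inv l])).
Qed.

Lemma word_mulVl w : word_eq (word_inv w ++ w) [::].
Proof. by have := word_mulV (word_inv w); rewrite word_invK. Qed.

Lemma repr_of_word w : word_eq (repr (of_word w)) w.
Proof. by apply/of_wordP; exact: reprK. Qed.

Lemma of_word_cat u v : of_word (u ++ v) = Gamma_mul (of_word u) (of_word v).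
Proof.
by apply/of_wordP; apply: word_eq_cat; apply: word_eq_sym; exact: repr_of_word.
Qed.

Fact Gamma_mulA : associative Gamma_mul.
Proof.
move=> g h k; have [u <-] := of_word_surj g; have [v <-] := of_word_surj h.
by have [w <-] := of_word_surj k; rewrite -!of_word_cat catA.
Qed.
Fact Gamma_mul1 : left_id Gamma_one Gamma_mul.
Proof. by move=> g; have [u <-] := of_word_surj g; rewrite -of_word_cat. Qed.
Fact Gamma_mulr1 : right_id Gamma_one Gamma_mul.
Proof.
by move=> g; have [u <-] := of_word_surj g; rewrite -of_word_cat cats0.
Qed.
Fact Gamma_mulV : left_inverse Gamma_one Gamma_inv Gamma_mul.
Proof.
move=> g; rewrite -[X in Gamma_mul _ X](reprK g) -of_word_cat.
by apply/of_wordP; exact: word_mulVl.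
Qed.
Fact Gamma_mulrV : right_inverse Gamma_one Gamma_inv Gamma_mul.
Proof.
move=> g; rewrite -[X in Gamma_mul X _](reprK g) -of_word_cat.
by apply/of_wordP; exact: word_mulV.
Qed.

HB.instance Definition _ := isGroup.Build Gamma
  Gamma_mulA Gamma_mul1 Gamma_mulr1 Gamma_mulV Gamma_mulrV.

Definition alpha : Gamma := of_word [:: la].
Definition beta : Gamma := of_word [:: lb].

Lemma of_wordM u v : of_word (u ++ v) = (of_word u * of_word v)%g.
Proof. exact: of_word_cat. Qed.

Lemma alpha2 : (alpha ^+ 2 = 1)%g.
Proof.
rewrite expgS expg1 /alpha -of_wordM; apply/of_wordP; exact: word_eq_alpha.
Qed.

Lemma beta3 : (beta ^+ 3 = 1)%g.
Proof.
rewrite !expgS expg0 mulg1 -(of_wordM [:: lb] [:: lb]).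
rewrite -(of_wordM [:: lb] [:: lb; lb]); apply/of_wordP; exact: word_eq_beta.
Qed.

Definition mx2 (a b c d : int) : 'M[int]_2 :=
  \matrix_(i < 2, j < 2) nth 0 (nth [::] [:: [:: a; b]; [:: c; d]] i) j.

Definition letter_mx (l : letter) : 'M[int]_2 :=
  let A := if l.1 then mx2 1 1 (-1) 0 else mx2 0 (-1) 1 0 in
  if l.2 then A^-1 else A.

(* The image of the word in PSL(2,Z) is the class of this matrix up to sign. *)
Definition word_mx (w : word) : 'M[int]_2 := \prod_(l <- w) letter_mx l.

(* [None] is the point at infinity. *)
Definition mobius (R : realType) (A : 'M[int]_2)
    (x : one_point_compactification R) : one_point_compactification R :=
  let a := (A 0 0)%:~R : R in let b := (A 0 1)%:~R : R in
  let c := (A 1 0)%:~R : R in let d := (A 1 1)%:~R : R in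
  match x with
  | None => if c == 0 then None else Some (a / c)
  | Some y =>
      if c * y + d == 0 then None else Some ((a * y + b) / (c * y + d))
  end.

(* Cutting the circle at the preimage of infinity, the identification is
   increasing from ]t0, t0 + 1[ to R. *)
Definition orientation_preserving_identification (R : realType)
    (theta : circle R -> one_point_compactification R) : Prop :=
  homeomorphism theta /\
  forall t0 s t x y : R,
    theta (to_circle t0) = None -> t0 < s -> s < t -> t < t0 + 1 ->
    theta (to_circle s) = Some x -> theta (to_circle t) = Some y -> x < y.

Definition circle_action (R : realType) : Type :=
  {multiplicative Gamma -> circle_homeo R}.

Definition fuchsian_action (R : realType) (phi : circle_action R) : Prop :=
  exists2 theta : circle R -> one_point_compactification R,
    orientation_preserving_identification theta &
    forall (w : word) (x : circle R),
      theta (phi (of_word w) x) = mobius (word_mx w) (theta x).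

(* On R/Z, [x *+ k] is the k-fold covering map. *)
Definition fold_lift (R : realType) (k : nat) (psi phi : circle_action R) :
  Prop := forall (g : Gamma) (x : circle R), phi g x *+ k = psi g (x *+ k).

(* The lift is required to be continuous, as a lift to the universal cover of
   a continuous map. Without this, a constant map would have the nondecreasing
   lift floor, and every action would be semi-conjugate to the trivial one. *)
Definition continuous_degree_one_monotone (R : realType)
    (h : circle R -> circle R) : Prop :=
  continuous h /\
  exists H : R -> R, [/\ continuous H, {homo H : x y / x <= y},
    commutes_with_translations H & is_lift H h].

Definition semi_conjugate (R : realType) (phi1 phi2 : circle_action R) :
    Prop :=
  exists2 h : circle R -> circle R, continuous_degree_one_monotone h &
    forall (g : Gamma) (x : circle R), h (phi1 g x) = phi2 g (h x).

(* [in_semi_conjugacy_class psi phi]: phi is in the class of psi. *)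
Definition in_semi_conjugacy_class (R : realType) (psi phi : circle_action R) :
    Prop :=
  clos_refl_sym_trans (circle_action R) (@semi_conjugate R) psi phi.

(* Main.v *)
(* Let a, b be lifts of phi(alpha), phi(beta) with a^2 = x + 1 and b^3 = x + m,
   and let (x_i) be the lifted periodic orbit of ab provided by its rotation
   number. With z_i the point a(x_j) lying in [x_i, x_(i+1)], the maps send the
   intervals [x_i, z_i] and [z_i, x_(i+1)] into each other in a ping-pong
   pattern which is the same for phi and for the target action, so every reduced
   word sends x_i and the corresponding point y_i of the target into gaps with
   the same index. Hence x |-> sup {g(y_i) : g(x_i) <= x} is finite; it is
   monotone and equivariant by construction, and continuous because its range
   is invariant under the target action, which is minimal.
   For 6/5 the position of the points a(x_i) has to be derived: if
   x_k <= a(x_j) < x_(k+1), then a gives x_(j+5) < a(x_(k+1)) and b gives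
   a(x_(k+1)) <= b(a(x_j)); applying b to x_(j+5) < b(a(x_j)) yields
   a(x_(j+6)) < x_(j+9). *)
Require Import Defs.
From mathcomp Require Import all_boot all_order all_algebra.
From mathcomp Require Import zify ring lra.
From mathcomp Require Import all_classical all_reals all_analysis.
Import numFieldNormedType.Exports.
Import Order.TTheory GRing.Theory Num.Theory.

Set Implicit Arguments.
Unset Strict Implicit.
Unset Printing Implicit Defensive.

Local Open Scope classical_set_scope.
Local Open Scope ring_scope.

(** * Integer induction and commutation with translations *)

Lemma int_bi_ind (P : int -> Prop) :
  P 0 -> (forall n, P n <-> P (n + 1)) -> forall n, P n.
Proof.
move=> P0 PS; elim/int_rect => // n IH.
  by rewrite -addn1 PoszD; exact/(PS n%:Z).1.
by apply/(PS (- n.+1%:Z)).2; rewrite (_ : _ + 1 = - n%:Z) //; lia.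
Qed.

Lemma shift1_commutes (R : realType) (F : R -> R) :
  (forall x, F (x + 1) = F x + 1) -> commutes_with_translations F.
Proof.
move=> F1 x; elim/int_bi_ind => [|n]; first by rewrite !addr0.
by rewrite intrD !addrA F1; split=> [->|/addIr].
Qed.

(** * Ping-pong orbits *)

(* The points [X i] project to a periodic orbit of [a \o b] on the circle, with
   [2 s + 1] points. On the [2 s + 1]-fold lift of the Fuchsian action, [a] and
   [b] are deck translations by [s] and [t] gaps followed by the basic moves;
   [(s, t, m) = (0, 0, 1)] is the Fuchsian action and [(2, 3, 2)] its 5-fold
   lift. *)
Record modular_orbit (R : realType) (s t m : int) (a b : R -> R)
    (X : int -> R) : Prop := ModularOrbit {
  mo_a_homo : {homo a : x y / x < y};
  mo_b_homo : {homo b : x y / x < y};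
  mo_aa : forall x, a (a x) = x + 1;
  mo_bbb : forall x, b (b (b x)) = x + m%:~R;
  mo_b1 : forall x, b (x + 1) = b x + 1;
  mo_X_homo : {homo X : i j / i < j};
  mo_X1 : forall i, X (i + (2 * s + 1)) = X i + 1;
  mo_ab : forall i, a (b (X i)) = X (i + (s + t + 1));
  mo_lb : forall i, X (i + s) <= a (X i);
  mo_ub : forall i, a (X i) <= X (i + s + 1) }.

Section ModularOrbit.
Variables (R : realType) (s t m : int) (a b : R -> R) (X : int -> R).
(** Consistency of the index counts: three applications of [b] move [X i] to [X (i + 3 t + 1)],
    while translation by [m] moves it by [m] periods of [2 s + 1] indices. *)
Hypothesis mst : m * (2 * s + 1) = 3 * t + 1.
Hypothesis oX : modular_orbit s t m a b X.

(** The shift by [s] places [Z i] between [X i] and [X (i + 1)]. Each gap is thus cut into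
    [[X i, Z i]], to which [b] and its square are applied, and [[Z i, X (i + 1)]], to which [a] is
    applied. *)
Let Z i := a (X (i - s)).

Lemma mo_a_mono : {mono a : x y / x <= y}.
Proof. exact: le_mono (mo_a_homo oX). Qed.

Lemma mo_b_mono : {mono b : x y / x <= y}.
Proof. exact: le_mono (mo_b_homo oX). Qed.

Lemma mo_X_le i j : i <= j -> X i <= X j.
Proof. by move=> ij; rewrite (le_mono (mo_X_homo oX)). Qed.

Lemma mo_X_shift i n : X (i + n * (2 * s + 1)) = X i + n%:~R.
Proof.
elim/int_bi_ind: n => [|n]; first by rewrite mul0r !addr0.
rewrite (mulrDl n) mul1r addrA (mo_X1 oX) intrD (addrA (X i)).
by split=> [->|/addIr].
Qed.

Lemma mo_a_shift : commutes_with_translations a.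
Proof. by apply: shift1_commutes => x; rewrite -!(mo_aa oX). Qed.

Lemma mo_b_shift : commutes_with_translations b.
Proof. exact: shift1_commutes (mo_b1 oX). Qed.

Lemma mo_aX i : a (X i) = Z (i + s).
Proof. by rewrite /Z addrK. Qed.

Lemma mo_aZ i : a (Z i) = X (i + s + 1).
Proof. by rewrite /Z (mo_aa oX) -(mo_X1 oX); congr X; lia. Qed.

Lemma mo_bX i : b (X i) = Z (i + t).
Proof.
apply: (inc_inj mo_a_mono); rewrite mo_aZ (mo_ab oX); congr X; lia.
Qed.

Lemma mo_bbZ i : b (b (Z i)) = X (i + 2 * t + 1).
Proof.
rewrite (_ : Z i = b (X (i - t))); last by rewrite mo_bX subrK.
by rewrite (mo_bbb oX) -mo_X_shift mst; congr X; lia.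
Qed.

Lemma mo_XZ i : X i <= Z i.
Proof. by have := mo_lb oX (i - s); rewrite subrK. Qed.

Lemma mo_ZX i : Z i <= X (i + 1).
Proof. by have := mo_ub oX (i - s); rewrite subrK. Qed.

Lemma mo_bZ_lb i : Z (i + t) <= b (Z i).
Proof. by rewrite -mo_bX mo_b_mono mo_XZ. Qed.

(** The two sides are compared after one more [b]: they become [X (i + 2 t + 1)] and
    [Z (i + 2 t + 1)]. *)
Lemma mo_bZ_ub i : b (Z i) <= X (i + t + 1).
Proof.
rewrite -mo_b_mono mo_bbZ mo_bX; apply: le_trans (mo_XZ _).
by apply: mo_X_le; lia.
Qed.

(** This and the next two lemmas are the ping-pong table. The index shifts [s + 1], [t] and [2 t]
    depend only on the parameters, so they agree for two actions of the same type. *)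
Lemma mo_a_ZX i x :
  Z i <= x <= X (i + 1) -> X (i + s + 1) <= a x <= Z (i + s + 1).
Proof.
by rewrite -mo_aZ (_ : i + s + 1 = i + 1 + s) -?mo_aX ?mo_a_mono //; lia.
Qed.

Lemma mo_b_XZ i x : X i <= x <= Z i -> Z (i + t) <= b x <= X (i + t + 1).
Proof.
move=> /andP[ix xi]; rewrite -mo_bX mo_b_mono ix /=.
by apply: le_trans (mo_bZ_ub i); rewrite mo_b_mono.
Qed.

Lemma mo_bb_XZ i x :
  X i <= x <= Z i -> Z (i + 2 * t) <= b (b x) <= X (i + 2 * t + 1).
Proof.
move=> /andP[ix xi]; rewrite -mo_bbZ !mo_b_mono xi andbT.
rewrite (_ : i + 2 * t = i + t + t); last by lia.
by apply: le_trans (mo_bZ_lb _) _; rewrite !mo_b_mono -mo_bX mo_b_mono.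
Qed.

Lemma mo_X_unbounded x : exists i, X i <= x < X (i + (2 * s + 1)).
Proof.
exists (Num.floor (x - X 0) * (2 * s + 1)).
rewrite (mo_X1 oX) -[X in X <= _]add0r.
have := mo_X_shift 0 (Num.floor (x - X 0)); rewrite !add0r => ->.
have := floor_le_tmp (x - X 0); have := floorD1_gt (x - X 0).
rewrite intrD; lra.
Qed.

End ModularOrbit.

(** * Comparison of two ping-pong orbits *)

(* The pairs [(g (X i), g (Y i))] for [g] in the group generated by the two
   generators, built along reduced words: the boolean is [true] after a power
   of [b], when [a] comes next. *)
Inductive paired (R : realType) (a b A B : R -> R) (X Y : int -> R) :
    bool -> R -> R -> Prop :=
| paired_base c i : paired a b A B X Y c (X i) (Y i)
| paired_a u v : paired a b A B X Y true u v ->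
    paired a b A B X Y false (a u) (A v)
| paired_b u v : paired a b A B X Y false u v ->
    paired a b A B X Y true (b u) (B v)
| paired_bb u v : paired a b A B X Y false u v ->
    paired a b A B X Y true (b (b u)) (B (B v)).

Definition same_orbit (R : realType) (a b A B : R -> R) (X Y : int -> R)
    (u v : R) : Prop := exists c, paired a b A B X Y c u v.

(** Minimality of the circle action, read on the line. For the lifts used here powers of [a] and [b]
    are translations, so invariance under [x - 1] also gives invariance under the inverses. *)
Definition minimal_pair (R : realType) (a b : R -> R) : Prop :=
  forall K : set R, closed K -> K !=set0 ->
    (forall x, K x -> K (a x)) -> (forall x, K x -> K (b x)) ->
    (forall x, K x -> K (x - 1)) -> forall x, K x.

Definition transfer (R : realType) (a b A B : R -> R) (X Y : int -> R)
    (x : R) : R :=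
  sup [set v | exists2 u, same_orbit a b A B X Y u v & u <= x].

(** A monotone map with dense range has no jumps: values of [H] slightly below and slightly above
    [H x] are attained, and monotonicity traps [H] between them near [x]. *)
Lemma monotone_dense_range_continuous (R : realType) (H : R -> R) :
  {homo H : x y / x <= y} -> (forall x, closure (range H) x) -> continuous H.
Proof.
move=> Hle Hd x; apply/cvgrPdist_lt => e e0.
have between c d : c < d -> exists z, c < H z < d.
  move=> cd; have [|y [/= [z _ zy]]] := Hd ((c + d) / 2) `]c, d[%classic.
    by apply: near_in_itvoo; rewrite in_itv /=; lra.
  by rewrite in_itv /= => ycd; exists z; rewrite zy.
have [y1 y1H] := between (H x - e) (H x) ltac:(lra).
have [y2 y2H] := between (H x) (H x + e) ltac:(lra).
have y1x : y1 < x by rewrite ltNge; apply/negP => /Hle; lra.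
have xy2 : x < y2 by rewrite ltNge; apply/negP => /Hle; lra.
have : \forall z \near x, z \in `]y1, y2[.
  by apply: near_in_itvoo; rewrite in_itv /= y1x.
apply: filterS => z; rewrite in_itv /= => /andP[/ltW y1z /ltW zy2].
by rewrite distrC ltr_distl; move: (Hle _ _ y1z) (Hle _ _ zy2); lra.
Qed.

Section Transfer.
Variables (R : realType) (s t m : int) (a b A B : R -> R) (X Y : int -> R).
Hypothesis mst : m * (2 * s + 1) = 3 * t + 1.
Hypothesis oX : modular_orbit s t m a b X.
Hypothesis oY : modular_orbit s t m A B Y.

Local Notation pair := (paired a b A B X Y).
Local Notation orb := (same_orbit a b A B X Y).
Local Notation H := (transfer a b A B X Y).

Lemma paired_shift c u v (n : int) :
  pair c u v -> pair c (u + n%:~R) (v + n%:~R).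
Proof.
elim=> {c u v} [c i|u v _ IH|u v _ IH|u v _ IH].
- by rewrite -(mo_X_shift oX) -(mo_X_shift oY); exact: paired_base.
- by rewrite -(mo_a_shift oX) -(mo_a_shift oY); exact: paired_a.
- by rewrite -(mo_b_shift oX) -(mo_b_shift oY); exact: paired_b.
- by rewrite -!(mo_b_shift oX) -!(mo_b_shift oY); exact: paired_bb.
Qed.

(** Induction along the reduced word: by the ping-pong table each letter changes the index by the
    same amount on both sides. *)
Lemma paired_location c u v : pair c u v -> exists i,
  if c then a (X (i - s)) <= u <= X (i + 1) /\ A (Y (i - s)) <= v <= Y (i + 1)
  else X i <= u <= a (X (i - s)) /\ Y i <= v <= A (Y (i - s)).
Proof.
elim=> {c u v} [[] i|u v _ [i [ui vi]]|u v _ [i [ui vi]]|u v _ [i [ui vi]]].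
(* Before a letter [a], the base point [X i] counts as the right end of [[Z (i - 1), X i]]. *)
- exists (i - 1).
  by move: (mo_ZX oX (i - 1)) (mo_ZX oY (i - 1)); rewrite subrK !lexx => -> ->.
- by exists i; rewrite !lexx (mo_XZ oX) (mo_XZ oY).
- by exists (i + s + 1); split;
    [exact: (mo_a_ZX mst oX ui)|exact: (mo_a_ZX mst oY vi)].
- by exists (i + t); split;
    [exact: (mo_b_XZ mst oX ui)|exact: (mo_b_XZ mst oY vi)].
- by exists (i + 2 * t); split;
    [exact: (mo_bb_XZ mst oX ui)|exact: (mo_bb_XZ mst oY vi)].
Qed.

Lemma orb_location u v :
  orb u v -> exists i, X i <= u <= X (i + 1) /\ Y i <= v <= Y (i + 1).
Proof.
move=> [[] /paired_location [i [/andP[ui iu] /andP[vi iv]]]]; exists i.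
  rewrite iu iv !andbT (le_trans _ ui) ?(le_trans _ vi) //.
    exact: mo_XZ oY i.
  exact: mo_XZ oX i.
rewrite ui vi (le_trans iu) ?(le_trans iv) //; first exact: mo_ZX oY i.
exact: mo_ZX oX i.
Qed.

Lemma orb_shift u v (n : int) : orb u v -> orb (u + n%:~R) (v + n%:~R).
Proof. by move=> [c uv]; exists c; exact: paired_shift. Qed.

(** Words in [paired] are reduced. If the word already starts with [a], the two letters collapse to
    a translation, which [paired_shift] absorbs; [orb_b] treats the cube of [b] in the same way. *)
Lemma orb_a u v : orb u v -> orb (a u) (A v).
Proof.
move=> [[] uv]; first by exists false; exact: paired_a.
case: _ _ _ / uv => [_ i|{}u {}v uv|{}u {}v uv|{}u {}v uv].
- by exists false; apply: paired_a; exact: paired_base.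
- by rewrite (mo_aa oX) (mo_aa oY); exists true; exact: (paired_shift 1).
- by exists false; apply: paired_a; exact: paired_b.
- by exists false; apply: paired_a; exact: paired_bb.
Qed.

Lemma orb_b u v : orb u v -> orb (b u) (B v).
Proof.
move=> [[] uv]; last by exists true; exact: paired_b.
case Ec : true _ _ / uv => [c i|{}u {}v uv|{}u {}v uv|{}u {}v uv] //.
- by exists true; apply: paired_b; exact: paired_base.
- by exists true; apply: paired_bb.
- by exists false; rewrite (mo_bbb oX) (mo_bbb oY); exact: paired_shift.
Qed.

Lemma orb_aV u v : orb (a u) (A v) -> orb u v.
Proof.
move=> /orb_a; rewrite (mo_aa oX) (mo_aa oY) => /(orb_shift (-1)).
by rewrite !addrK.
Qed.

Lemma orb_bV u v : orb (b u) (B v) -> orb u v.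
Proof.
move=> /orb_b/orb_b; rewrite (mo_bbb oX) (mo_bbb oY) => /(orb_shift (- m)).
by rewrite !intrN !addrK.
Qed.

(** The universal property of the supremum, through which all later inequalities on [H] are
    proved. *)
Lemma transfer_le x y :
  (forall u v, orb u v -> u <= x -> v <= y) <-> H x <= y.
Proof.
have [i /andP[ix xi]] := mo_X_unbounded oX x.
(* The supremum is a genuine one: [u] and [v] lie in gaps of equal index, so [u <= x] bounds the
   index and hence [v]. *)
have ub : has_ubound [set v | exists2 u, orb u v & u <= x].
  exists (Y (i + (2 * s + 1) + 1)) => v [u /orb_location [j [uj vj]] ux].
  case/andP: vj => _ /le_trans; apply; apply: mo_X_le oY _ _ _.
  have : X j < X (i + (2 * s + 1)) by case/andP: uj => uj _; lra.
  by rewrite (leW_mono (le_mono (mo_X_homo oX))); lia.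
split=> [xy|Hxy u v uv ux].
  apply: ge_sup => [|v [u uv ux]]; last exact: xy uv ux.
  by exists (Y i), (X i) => //; exists true; exact: paired_base.
by apply: le_trans Hxy; apply: ub_le_sup => //; exists u.
Qed.

Lemma transfer_homo : {homo H : x y / x <= y}.
Proof.
move=> x y xy; apply/transfer_le => u v uv ux.
by move/transfer_le: (lexx (H y)); apply; [exact: uv|exact: le_trans xy].
Qed.

(** The pairs below [f x] are the images of the pairs below [x], and an increasing bijection
    commutes with suprema. *)
Lemma transfer_equivariant (f f' F F' : R -> R) :
  cancel f' f -> cancel F' F -> cancel F F' ->
  {mono f : x y / x <= y} -> {mono F : x y / x <= y} ->
  (forall u v, orb u v -> orb (f u) (F v)) ->
  (forall u v, orb (f u) (F v) -> orb u v) ->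
  forall x, H (f x) = F (H x).
Proof.
move=> fK FK FK' fle Fle orbf orbfV x; apply/eqP; rewrite eq_le.
apply/andP; split.
  apply/transfer_le => u v; rewrite -{1}(fK u) -{1}(FK v) => /orbfV uv.
  rewrite -{1}(fK u) fle -{1}(FK v) Fle => ux.
  by move/transfer_le: (lexx (H x)); apply; [exact: uv|].
rewrite -[X in _ <= X]FK Fle; apply/transfer_le => u v /orbf uv ux.
rewrite -Fle FK; move/transfer_le: (lexx (H (f x))).
by apply; [exact: uv|rewrite fle].
Qed.

Lemma transfer_a x : H (a x) = A (H x).
Proof.
apply: (@transfer_equivariant _ (fun x => a (x - 1)) _ (fun x => A (x - 1))).
- by move=> z; rewrite (mo_aa oX) subrK.
- by move=> z; rewrite (mo_aa oY) subrK.
- by move=> z; have := mo_a_shift oY (A z) (-1); rewrite (mo_aa oY) addrK.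
- exact: mo_a_mono oX.
- exact: mo_a_mono oY.
- exact: orb_a.
- exact: orb_aV.
Qed.

Lemma transfer_b x : H (b x) = B (H x).
Proof.
apply: (@transfer_equivariant _ (fun x => b (b (x - m%:~R))) _
  (fun x => B (B (x - m%:~R)))).
- by move=> z; rewrite (mo_bbb oX) subrK.
- by move=> z; rewrite (mo_bbb oY) subrK.
- by move=> z; rewrite -intrN !(mo_b_shift oY) (mo_bbb oY) intrN addrK.
- exact: mo_b_mono oX.
- exact: mo_b_mono oY.
- exact: orb_b.
- exact: orb_bV.
Qed.

Lemma transfer_shift : commutes_with_translations H.
Proof.
apply: shift1_commutes => x.
by rewrite -(mo_aa oX x) !transfer_a (mo_aa oY).
Qed.

Lemma transfer_continuous :
  continuous A -> continuous B -> minimal_pair A B -> continuous H.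
Proof.
move=> Ac Bc Amin; apply: monotone_dense_range_continuous.
  exact: transfer_homo.
have clos f : continuous f -> (forall x, range H x -> range H (f x)) ->
    forall x, closure (range H) x -> closure (range H) (f x).
  move=> fc fH x Hx V /fc /Hx [y [/fH fy Vy]].
  by exists (f y).
apply: Amin; [exact: closed_closure| | | |].
- by exists (H 0); apply: subset_closure; exists 0.
- by apply: clos => // x [y _ <-]; exists (a y) => //; exact: transfer_a.
- by apply: clos => // x [y _ <-]; exists (b y) => //; exact: transfer_b.
- apply: clos => [x|x [y _ <-]].
    by apply: cvgB; [exact: cvg_id|exact: cvg_cst].
  by exists (y - 1) => //; exact: (transfer_shift y (-1)).
Qed.

End Transfer.

(** * From maps of the line to actions on the circle *)

Lemma to_circle_shift (R : realType) (x : R) (n : int) :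
  to_circle (x + n%:~R) = to_circle x.
Proof. by apply/to_circle_eq; rewrite addrC addKr intr_int. Qed.

Lemma to_circle_eqP (R : realType) (x y : R) :
  to_circle x = to_circle y <-> exists n : int, x = y + n%:~R.
Proof.
split=> [/to_circle_eq/intrP [n xy]|[n ->]]; last exact: to_circle_shift.
by exists n; rewrite -xy addrC subrK.
Qed.

(** Inverse letters are eliminated by writing the inverse of [alpha] as [alpha] and that of [beta]
    as [beta * beta]. *)
Lemma of_word_ind (P : Gamma -> Prop) :
  P 1%g -> (forall g, P g -> P (alpha * g)%g) ->
  (forall g, P g -> P (beta * g)%g) -> forall g, P g.
Proof.
move=> P1 Pa Pb g; have [w <-] := of_word_surj g.
elim: w => [//|l w IH]; rewrite -cat1s of_wordM; case: l => -[] [].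
- rewrite (_ : of_word _ = beta * beta)%g.
    by rewrite -mulgA; apply: (Pb); exact: Pb.
  rewrite -of_wordM; apply/of_wordP.
  apply: word_eq_trans (word_eq_cat (word_eq_refl [:: lb; lb])
    (word_eq_cancel lb)).
  exact: word_eq_sym (word_eq_cat word_eq_beta (word_eq_refl _)).
- exact: Pb.
- rewrite (_ : of_word _ = alpha)%g; first exact: Pa.
  apply/of_wordP.
  apply: word_eq_trans (word_eq_cat (word_eq_refl [:: la])
    (word_eq_cancel la)).
  exact: word_eq_sym (word_eq_cat word_eq_alpha (word_eq_refl _)).
- exact: Pa.
Qed.

Lemma circle_action1 (R : realType) (phi : circle_action R) :
  phi 1%g = 1%g.
Proof. by apply: (mulgI (phi 1%g)); rewrite -gmulfM !mulg1. Qed.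

Lemma semi_conjugate_of_lifts (R : realType) (phi psi : circle_action R)
    (a b A B H : R -> R) :
  is_lift a (phi alpha) -> is_lift b (phi beta) ->
  is_lift A (psi alpha) -> is_lift B (psi beta) ->
  continuous H -> {homo H : x y / x <= y} -> commutes_with_translations H ->
  (forall x, H (a x) = A (H x)) -> (forall x, H (b x) = B (H x)) ->
  semi_conjugate phi psi.
Proof.
move=> la lb lA lB Hc Hle H1 Ha Hb.
(* The choice of representative is harmless because [H] commutes with integer translations. *)
pose h (u : circle R) := to_circle (H (repr u)).
have hE x : h (to_circle x) = to_circle (H x).
  have /to_circle_eqP [n xn] : to_circle (repr (to_circle x)) = to_circle x.
    exact: reprK.
  by rewrite /h xn H1 to_circle_shift.
exists h.
  split; last by exists H; split => // x; exact: hE.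
  apply/quotient_continuous; rewrite (_ : _ \o _ = @to_circle R \o H).
    by move=> x; apply: continuous_comp;
      [exact: Hc|exact: to_circle_continuous].
  by apply/funext => x; exact: hE.
elim/of_word_ind => [u|g IH u|g IH u].
- by rewrite !circle_action1.
- have [x xu] := to_circle_surj (phi g u); have := IH u.
  by rewrite !gmulfM /= -xu hE la hE Ha -lA => ->.
- have [x xu] := to_circle_surj (phi g u); have := IH u.
  by rewrite !gmulfM /= -xu hE lb hE Hb -lB => ->.
Qed.

Lemma modular_orbit_semi_conjugate (R : realType) (phi psi : circle_action R)
    (s t m : int) (a b A B : R -> R) (X Y : int -> R) :
  m * (2 * s + 1) = 3 * t + 1 ->
  is_lift a (phi alpha) -> is_lift b (phi beta) ->
  is_lift A (psi alpha) -> is_lift B (psi beta) ->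
  modular_orbit s t m a b X -> modular_orbit s t m A B Y ->
  continuous A -> continuous B -> minimal_pair A B ->
  semi_conjugate phi psi.
Proof.
move=> mst la lb lA lB oX oY Ac Bc Amin.
apply: (semi_conjugate_of_lifts la lb lA lB).
- exact: (transfer_continuous mst oX oY).
- exact: (transfer_homo mst oX oY).
- exact: (transfer_shift mst oX oY).
- exact: (transfer_a mst oX oY).
- exact: (transfer_b mst oX oY).
Qed.

Lemma bounded_multiples_eq0 (R : realType) (c C : R) :
  (forall n, `|n%:R * c| <= C) -> c = 0.
Proof.
move=> cC; apply/eqP; apply: contraT => c0.
have := cC (Num.truncn (C / `|c|)).+1; rewrite normrM normr_nat.
by rewrite -ler_pdivlMr ?normr_gt0 // leNgt truncnS_gt.
Qed.

(** * Translation numbers *)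

Lemma natr_intr_mul (R : pzRingType) (n : nat) (p : int) :
  n%:R * p%:~R = (n%:Z * p)%:~R :> R.
Proof. by rewrite intrM. Qed.

Section TranslationNumber.
Variables (R : realType) (F : R -> R).
Hypotheses (Flt : {homo F : x y / x < y}) (F1 : commutes_with_translations F).

Lemma iter_homo_le n : {homo iter n F : x y / x <= y}.
Proof.
elim: n => [//|n IH] x y /IH xy; rewrite !iterS.
by rewrite (le_mono Flt).
Qed.

Lemma iter_commutes n : commutes_with_translations (iter n F).
Proof. by elim: n => [//|n IH] x k; rewrite !iterS IH F1. Qed.

(** [x] lies between two consecutive integers, where the displacement of [iter n F] is that of 0. *)
Lemma iter_displacement n x : `|iter n F x - x - iter n F 0| <= 1.
Proof.
have /andP[fx xf] : (Num.floor x)%:~R <= x <= (Num.floor x)%:~R + 1.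
  by have := floor_le_tmp x; have := floorD1_gt x; rewrite intrD; lra.
have := iter_homo_le n fx; have := iter_homo_le n xf.
have := iter_commutes n 0 (Num.floor x); rewrite add0r => ->.
have := iter_commutes n 0 (Num.floor x + 1); rewrite add0r intrD => ->.
by rewrite ler_norml; lra.
Qed.

Lemma iter_mul_displacement m n :
  `|iter (m * n) F 0 - iter m F 0 *+ n| <= n%:R.
Proof.
elim: n => [|n IH]; first by rewrite muln0 mulr0n subrr normr0.
have := iter_displacement m (iter (m * n) F 0); rewrite -iterD -mulnS.
by move: IH; rewrite mulrS -natr1 !ler_norml; lra.
Qed.

Lemma translation_number_cvg (rho C : R) :
  (forall n, `|iter n F 0 - n%:R * rho| <= C) -> translation_number F = rho.
Proof.
move=> FC; apply: cvg_lim => //; apply/cvgrPdist_le => e e0.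
near=> n; have n0 : 0 < n%:R :> R by rewrite ltr0n; near: n; exists 1%N.
rewrite distrC subr0 -(ler_pM2r n0) -{2}(gtr0_norm n0) -normrM mulrBl divfK
  ?gt_eqF //.
rewrite mulrC; apply: le_trans (FC n) _.
rewrite mulrC -ler_pdivrMr //; near: n; exact: nbhs_infty_ger.
Unshelve. all: by end_near. Qed.

(** Evaluating [iter (m * k) F 0] in two ways shows that every [(iter m F 0 - 1) / m] is at most
    every [(iter k F 0 + 1) / k]. The supremum of the former is therefore within [1 / n] of each
    quotient, and so it is the limit. *)
Lemma translation_numberP n :
  `|iter n F 0 - n%:R * translation_number F| <= 1.
Proof.
pose S := [set ((iter m.+1 F 0 - 1) / m.+1%:R : R) | m in [set: nat]].
have S0 : S !=set0 by exists ((iter 1 F 0 - 1) / 1), 0%N.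
have Sub k : ubound S ((iter k.+1 F 0 + 1) / k.+1%:R).
  move=> _ [m _ <-]; rewrite ler_pdivrMr ?ltr0n // mulrAC ler_pdivlMr ?ltr0n //.
  have := iter_mul_displacement m.+1 k.+1.
  have := iter_mul_displacement k.+1 m.+1.
  rewrite (mulnC k.+1) -(mulr_natr (iter m.+1 F 0)).
  rewrite -(mulr_natr (iter k.+1 F 0)).
  rewrite !ler_norml; move: (iter (_ * _) F 0).
  move: (iter m.+1 F 0) (iter k.+1 F 0) (m.+1%:R) (k.+1%:R).
  by move=> *; lra.
have supP m : `|iter m F 0 - m%:R * sup S| <= 1.
  case: m => [|m]; first by rewrite mul0r subrr normr0.
  have m0 : 0 < m.+1%:R :> R by rewrite ltr0n.
  have := ge_sup S0 (Sub m); rewrite ler_pdivlMr // => ub.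
  have : (iter m.+1 F 0 - 1) / m.+1%:R <= sup S.
    apply: ub_le_sup; last by exists m.
    by exists ((iter 1 F 0 + 1) / 1); exact: (Sub 0%N).
  rewrite ler_pdivrMr // ler_norml.
  move: ub; move: (iter _ F 0) (m.+1%:R) (sup S).
  by move=> *; lra.
by rewrite (translation_number_cvg supP).
Qed.

Lemma translation_number_periodic x q (p : int) :
  iter q F x = x + p%:~R -> q%:R * translation_number F = p%:~R.
Proof.
move=> Fx; apply/eqP; rewrite -subr_eq0; apply/eqP.
(* The constant 2 is 1 for moving the base point from [x] to 0 plus 1 from [translation_numberP]. *)
apply: (@bounded_multiples_eq0 _ _ 2) => n.
have Fn : iter (q * n) F x = x + n%:R * p%:~R.
  elim: n => [|n IH]; first by rewrite muln0 mul0r addr0.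
  rewrite mulnS iterD IH natr_intr_mul iter_commutes Fx -natr_intr_mul -natr1.
  by ring.
have := translation_numberP (q * n); have := iter_displacement (q * n) x.
by rewrite Fn natrM !ler_norml; lra.
Qed.

End TranslationNumber.

(** The orbit of 0 is monotone, in the direction given by the sign of [G 0]; being bounded it
    converges, and continuity makes the limit fixed. *)
Lemma bounded_orbit_fixed_point (R : realType) (G : R -> R) (C : R) :
  continuous G -> {homo G : x y / x <= y} ->
  (forall n, `|iter n G 0| <= C) -> exists x, G x = x.
Proof.
move=> Gc Gle GC; pose u n := iter n G 0.
suff cu : cvgn u.
  have Gu : (G \o u) @ \oo --> G (limn u).
    by apply: continuous_cvg; [exact: Gc|exact: cu].
  exists (limn u); apply/esym/cvg_lim => //.
  by rewrite -(cvg_shiftS u).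
have bu : bounded_fun u.
  by exists C; split=> [|M CM n _];
    [exact: num_real|exact: le_trans (GC n) (ltW CM)].
have [G0|/ltW G0] := leP 0 (G 0).
  apply: nondecreasing_is_cvgn; last exact/bounded_fun_has_ubound.
  by apply/nondecreasing_seqP => n; elim: n => //= n IH; exact: Gle.
apply: nonincreasing_is_cvgn; last exact/bounded_fun_has_lbound.
by apply/nonincreasing_seqP => n; elim: n => //= n IH; exact: Gle.
Qed.

Lemma continuous_iter (T : topologicalType) (f : T -> T) n :
  continuous f -> continuous (iter n f).
Proof.
move=> fc; elim: n => [|n IH] x; first exact: cvg_id.
by apply: continuous_comp; [exact: IH|exact: fc].
Qed.

(** A fixed point is sought for [iter q F - p], whose orbit of 0 stays within 1 by
    [translation_numberP]. *)
Lemma periodic_point (R : realType) (F : R -> R) (q : nat) (p : int) :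
  continuous F -> {homo F : x y / x < y} -> commutes_with_translations F ->
  q%:R * translation_number F = p%:~R -> exists x, iter q F x = x + p%:~R.
Proof.
move=> Fc Flt F1 qp; pose G x := iter q F x + (- p)%:~R.
have GE n : iter n G 0 = iter (q * n) F 0 - n%:R * p%:~R.
  elim: n => [|n IH]; first by rewrite muln0 mul0r subr0.
  rewrite iterS IH /G mulnS iterD -mulrN -intrN natr_intr_mul iter_commutes //.
  by rewrite -natr_intr_mul -natr1 intrN; ring.
have [||n|x Gx] := @bounded_orbit_fixed_point _ G 1.
- by move=> x; apply: cvgD; [exact: continuous_iter|exact: cvg_cst].
- by move=> x y xy; rewrite lerD2r; exact: iter_homo_le.
- rewrite GE -qp mulrA (mulrC n%:R) -natrM; exact: translation_numberP.
- by exists x; rewrite -{2}Gx /G intrN subrK.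
Qed.

Lemma translation_numberD (R : realType) (F : R -> R) (k : int) :
  {homo F : x y / x < y} -> commutes_with_translations F ->
  translation_number (fun x => F x + k%:~R) = translation_number F + k%:~R.
Proof.
move=> Flt F1; apply: (@translation_number_cvg _ _ _ 1) => n.
have -> : iter n (fun x => F x + k%:~R) 0 = iter n F 0 + n%:R * k%:~R.
  elim: n => [|n IH]; first by rewrite mul0r addr0.
  by rewrite !iterS IH natr_intr_mul F1 -natr_intr_mul -natr1; ring.
rewrite (_ : _ - _ = iter n F 0 - n%:R * translation_number F); last by ring.
exact: translation_numberP.
Qed.

(** The integer difference [N] cannot decrease from [x] to a [y] in [[x, x + 1]], because
    [F x < F y] and [G y <= G x + 1]; its [q]-periodicity then makes it constant. [q = 1] compares
    two lifts of one homeomorphism, general [q] serves fold lifts. *)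
Lemma lifts_differ_by_translation (R : realType) (F G : R -> R) (q : nat) :
  (0 < q)%N -> {homo F : x y / x < y} -> {homo G : x y / x < y} ->
  (forall x, F (x + q%:R) = F x + q%:R) -> commutes_with_translations G ->
  (forall x, to_circle (F x) = to_circle (G x)) ->
  exists N : int, forall x, F x = G x + N%:~R.
Proof.
move=> q0 Flt Glt Fq G1 FG.
have /choice [N FN] x : exists n : int, F x = G x + n%:~R.
  exact/to_circle_eqP.
have Nle x y : x <= y <= x + 1 -> N x <= N y.
  rewrite le_eqVlt => /andP[/predU1P[->//|/Flt Fxy] yx].
  rewrite -ltzD1 -(ltr_int R) intrD.
  have : G y <= G (x + 1) by rewrite (le_mono Glt).
  by move: Fxy; rewrite (G1 x 1) !FN !mulr1z; lra.
have Nleq x k : N x <= N (x + k%:R).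
  elim: k => [|k IH]; first by rewrite addr0.
  by apply: le_trans IH _; apply: Nle; rewrite -natr1; lra.
have Nq x : N (x + q%:R) = N x.
  apply/eqP; rewrite -(eqr_int R); apply/eqP; have := Fq x.
  by rewrite !FN pmulrn G1; lra.
have N1 x y : x <= y <= x + 1 -> N y = N x.
  move=> xy; apply/eqP; rewrite eq_le (Nle _ _ xy) andbT -(Nq x).
  apply: (@le_trans _ _ (N (x + 1))); first by apply: Nle; lra.
  by have := Nleq (x + 1) q.-1; rewrite -addrA nat1r prednK.
have Nz (k : int) : N k%:~R = N 0.
  elim/int_bi_ind: k => // k; rewrite -(N1 k%:~R (k + 1)%:~R) //.
  by rewrite intrD; lra.
exists (N 0) => x; rewrite FN; congr (_ + _%:~R).
rewrite -(Nz (Num.floor x)); apply: N1.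
by have := floor_le_tmp x; have := floorD1_gt x; rewrite intrD; lra.
Qed.

(** * Orbits of actions with prescribed rotation numbers *)

Section HomeoLifts.
Variable R : realType.
Implicit Types (f g : circle_homeo R) (F G : R -> R).

Lemma homeo_lift_continuous F f : is_homeo_lift F f -> continuous F.
Proof. by move=> [[G []]]. Qed.

Lemma homeo_lift_comp F G f g :
  is_homeo_lift F f -> is_homeo_lift G g ->
  is_homeo_lift (fun x => F (G x)) (f * g)%g.
Proof.
move=> [hF Flt F1 Ff] [hG Glt G1 Gg]; split.
- exact: comp_homeomorphism hF hG.
- by move=> x y /Glt/Flt.
- by move=> x n; rewrite G1 F1.
- by move=> x /=; rewrite Gg Ff.
Qed.

Lemma homeo_lift_shift F f (k : int) :
  is_homeo_lift F f -> is_homeo_lift (fun x => F x + k%:~R) f.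
Proof.
move=> [[G [Fc Gc FK GK]] Flt F1 Ff]; split.
- exists (fun x => G (x - k%:~R)); split.
  + by move=> x; apply: cvgD; [exact: Fc|exact: cvg_cst].
  + move=> x; apply: (@continuous_comp R R R (fun y => y - k%:~R) G x).
      by apply: cvgB; [exact: cvg_id|exact: cvg_cst].
    exact: Gc.
  + by move=> x; rewrite addrK FK.
  + by move=> x; rewrite GK subrK.
- by move=> x y /Flt; rewrite ltrD2r.
- by move=> x n; rewrite F1 addrAC.
- by move=> x; rewrite to_circle_shift.
Qed.

Lemma homeo_lift_unique F G f :
  is_homeo_lift F f -> is_homeo_lift G f ->
  exists N : int, forall x, F x = G x + N%:~R.
Proof.
move=> [_ Flt F1 Ff] [_ Glt G1 Gf].
apply: (@lifts_differ_by_translation _ _ _ 1) => // x; first exact: (F1 x 1).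
by rewrite -Ff -Gf.
Qed.

Lemma homeo_lift1 F :
  is_homeo_lift F (1 : circle_homeo R)%g ->
  exists N : int, forall x, F x = x + N%:~R.
Proof.
move=> F1; apply: (homeo_lift_unique F1); split => //.
exact: id_homeomorphism.
Qed.

Lemma homeo_lift_of_rotation_number f (rho : R) :
  rotation_number f = to_circle rho ->
  exists2 F, is_homeo_lift F f & translation_number F = rho.
Proof.
have fP := homeo_liftP f; case: (fP) => _ Flt F1 _.
move=> /to_circle_eqP [n frho].
exists (fun x => homeo_lift f x + (- n)%:~R); first exact: homeo_lift_shift.
by rewrite translation_numberD // frho intrN addrK.
Qed.

(** [F] composed with itself lifts the identity, hence is an integer translation, and the
    translation number identifies the integer. *)
Lemma homeo_lift_order2 F f (p : int) :
  (f * f = 1)%g -> is_homeo_lift F f -> translation_number F = p%:~R / 2 ->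
  forall x, F (F x) = x + p%:~R.
Proof.
move=> ff Ff Fp x; have := homeo_lift_comp Ff Ff.
rewrite ff => /homeo_lift1 [N FN].
rewrite FN; congr (_ + _); case: Ff => _ Flt F1 _.
by rewrite -(@translation_number_periodic _ _ Flt F1 0 2 N (FN 0)) Fp mulrC
  divfK.
Qed.

Lemma homeo_lift_order3 F f (p : int) :
  (f * f * f = 1)%g -> is_homeo_lift F f -> translation_number F = p%:~R / 3 ->
  forall x, F (F (F x)) = x + p%:~R.
Proof.
move=> fff Ff Fp x; have := homeo_lift_comp (homeo_lift_comp Ff Ff) Ff.
rewrite fff => /homeo_lift1 [N FN].
rewrite FN; congr (_ + _); case: Ff => _ Flt F1 _.
by rewrite -(@translation_number_periodic _ _ Flt F1 0 3 N (FN 0)) Fp mulrC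
  divfK.
Qed.

End HomeoLifts.

Lemma circle_action_alpha2 (R : realType) (phi : circle_action R) :
  (phi alpha * phi alpha = 1)%g.
Proof.
rewrite -gmulfM (_ : alpha * alpha = 1)%g ?circle_action1 //.
by rewrite -[in RHS]alpha2 expgS expg1.
Qed.

Lemma circle_action_beta3 (R : realType) (phi : circle_action R) :
  (phi beta * phi beta * phi beta = 1)%g.
Proof.
rewrite -!gmulfM (_ : beta * beta * beta = 1)%g ?circle_action1 //.
by rewrite -[in RHS]beta3 !expgS expg0 mulg1 mulgA.
Qed.

Section RootsOfTranslation.
Variables (R : realType) (F : R -> R).
Hypothesis Flt : {homo F : x y / x < y}.

Lemma sqrt_translation_bounds :
  (forall x, F (F x) = x + 1) -> forall x, x < F x < x + 1.
Proof.
move=> FF x; have xF : x < F x.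
  rewrite ltNge; apply/negP => Fx.
  have : F (F x) <= F x by rewrite (le_mono Flt).
  by rewrite FF; lra.
by rewrite xF -FF; exact: Flt.
Qed.

Lemma cbrt_translation_bounds (m : int) : 0 < m < 3 ->
  commutes_with_translations F ->
  (forall x, F (F (F x)) = x + m%:~R) -> forall x, x < F x < x + 1.
Proof.
move=> /andP[m0 m3] F1 FFF x; have Fle := le_mono Flt.
have m0R : 0 < m%:~R :> R by rewrite ltr0z.
have m3R : m%:~R < 3 :> R by rewrite (ltr_int R m 3).
apply/andP; split; rewrite ltNge; apply/negP => h.
  have h2 : F (F x) <= F x by rewrite Fle.
  have h3 : F (F (F x)) <= F (F x) by rewrite Fle.
  by have := FFF x; lra.
have h2 : F x + 1 <= F (F x) by rewrite -(F1 x 1) Fle.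
have h3 : F (F x) + 1 <= F (F (F x)) by rewrite -(F1 (F x) 1) Fle.
by have := FFF x; lra.
Qed.

End RootsOfTranslation.

(** With one orbit point per unit interval, the position required of [a (X i)] is just
    [x < a x < x + 1]. *)
Lemma modular_orbit_fixed_point (R : realType) (a b : R -> R) (x0 : R) :
  {homo a : x y / x < y} -> {homo b : x y / x < y} ->
  (forall x, a (a x) = x + 1) -> (forall x, b (b (b x)) = x + 1) ->
  commutes_with_translations b -> a (b x0) = x0 + 1 ->
  modular_orbit 0 0 1 a b (fun i => x0 + i%:~R).
Proof.
move=> alt blt aa bbb b1 ab.
have ax := sqrt_translation_bounds alt aa.
have a1 : commutes_with_translations a.
  by apply: shift1_commutes => x; rewrite -!aa.
split=> //.
- by move=> x; exact: (b1 x 1).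
- by move=> i j ij; rewrite ltrD2l ltr_int.
- by move=> i; rewrite mulr0 add0r intrD addrA.
- by move=> i; rewrite b1 a1 ab !add0r intrD addrA addrAC.
- by move=> i; rewrite addr0; case/andP: (ax (x0 + i%:~R)) => /ltW.
- by move=> i; rewrite addr0 intrD addrA;
    case/andP: (ax (x0 + i%:~R)) => _ /ltW.
Qed.

(* The two bounds on [a (X i)] are not assumed: they are forced by the rotation
   number 6/5 of [a \o b], the largest one for these orders of [a] and [b]. *)
Lemma modular_orbit_five (R : realType) (a b : R -> R) (X : int -> R) :
  {homo a : x y / x < y} -> {homo b : x y / x < y} ->
  (forall x, a (a x) = x + 1) -> (forall x, b (b (b x)) = x + 2) ->
  commutes_with_translations b ->
  {homo X : i j / i < j} -> (forall i, X (i + 5) = X i + 1) ->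
  (forall i, a (b (X i)) = X (i + 6)) ->
  modular_orbit 2 3 2 a b X.
Proof.
move=> alt blt aa bbb b1 Xlt X5 ab.
have ale := le_mono alt; have ble := le_mono blt.
pose z i := a (X i).
have az i : a (z i) = X (i + 5) by rewrite /z aa X5.
have bX i : b (X i) = z (i + 1).
  by apply: (inc_inj ale); rewrite ab az; congr X; lia.
have bbz i : b (b (z i)) = X (i + 9).
  have -> : z i = b (X (i - 1)) by rewrite bX subrK.
  rewrite bbb.
  by rewrite (_ : i + 9 = i - 1 + 5 + 5) ?X5; [lra|lia].
have zbounds i : X i < z i < X (i + 5).
  by rewrite X5; exact: (sqrt_translation_bounds alt aa).
have locate j : exists k, X k <= z j < X (k + 1).
  have [h1|h1] := ltP (z j) (X (j + 1)).
    by exists j; rewrite h1; case/andP: (zbounds j) => /ltW ->.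
  have [h2|h2] := ltP (z j) (X (j + 2)).
    by exists (j + 1); rewrite h1 -addrA.
  have [h3|h3] := ltP (z j) (X (j + 3)).
    by exists (j + 2); rewrite h2 -addrA.
  have [h4|h4] := ltP (z j) (X (j + 4)).
    by exists (j + 3); rewrite h3 -addrA.
  by exists (j + 4); rewrite h4 -addrA; case/andP: (zbounds j).
have ub i : z i < X (i + 3).
  have [k /andP[kz zk]] := locate (i - 6).
  have : X (i - 6 + 5) < b (z (i - 6)).
    by apply: (@lt_le_trans _ _ (z (k + 1))); [rewrite -az alt|rewrite -bX ble].
  move/blt; rewrite bX bbz (_ : i - 6 + 5 + 1 = i); last by lia.
  by rewrite (_ : i - 6 + 9 = i + 3) //; lia.
split=> //.
- by move=> x; exact: (b1 x 1).
(* The lower bound is the image under [a] of the upper bound at [i - 3]. *)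
- move=> i; apply/ltW; have /alt := ub (i - 3).
  by rewrite az subrK (_ : i - 3 + 5 = i + 2) //; lia.
- by move=> i; rewrite -addrA; exact/ltW/ub.
Qed.

Section PeriodicOrbit.
Variables (R : realType) (g : R -> R) (q : nat) (x0 : R).
Hypotheses (glt : {homo g : x y / x < y}) (g1 : commutes_with_translations g).
Hypothesis gq : iter q g x0 = x0 + 1.

(** This is the [i]-th iterate of [g] at [x0] for every integer [i]; Euclidean division by [q]
    replaces negative iterates. *)
Definition periodic_orbit (i : int) : R :=
  iter `|(i %% q)%Z| g x0 + (i %/ q)%Z%:~R.

Lemma period_gt0 : (0 < q)%N.
Proof. by case: q gq => //=; lra. Qed.

Lemma periodic_orbitE (k : int) (r : nat) :
  periodic_orbit (k * q + r) = iter r g x0 + k%:~R.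
Proof.
have q0 : q != 0 :> int by have := period_gt0; lia.
rewrite /periodic_orbit divzMDl // modzMDl divz_nat modz_nat absz_nat.
rewrite [in RHS](divn_eq r q) addnC iterD intrD addrA addrAC; congr (_ + _).
have it d : iter (d * q) g x0 = x0 + d%:Z%:~R.
  elim: d => [|d IH]; first by rewrite mul0n addr0.
  by rewrite mulSn iterD IH (iter_commutes g1) gq -addn1 PoszD intrD addrAC
    addrA.
by rewrite it (iter_commutes g1).
Qed.

Lemma periodic_orbit_period (i : int) :
  periodic_orbit (i + q%:Z) = periodic_orbit i + 1.
Proof.
have q0 : q != 0 :> int by have := period_gt0; lia.
rewrite (divz_eq i q) -(gez0_abs (modz_ge0 i q0)).
set k := (i %/ q)%Z; set r := `|_|%N.
rewrite (_ : k * q + r + q = (k + 1) * q + r); last by ring.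
by rewrite !periodic_orbitE intrD addrA.
Qed.

Lemma periodic_orbit_succ i : periodic_orbit (i + 1) = g (periodic_orbit i).
Proof.
have q0 : q != 0 :> int by have := period_gt0; lia.
rewrite (divz_eq i q) -(gez0_abs (modz_ge0 i q0)).
by rewrite -addrA -PoszD addn1 !periodic_orbitE iterS g1.
Qed.

(** Dynamical order agrees with the order of the line: if [g] did not move an orbit point up,
    neither would [iter q g], which adds 1. *)
Lemma periodic_orbit_homo : {homo periodic_orbit : i j / i < j}.
Proof.
have it i n : periodic_orbit (i + n%:Z) = iter n g (periodic_orbit i).
  by elim: n => [|n IH]; rewrite ?addr0 // -addn1 PoszD addrA
    periodic_orbit_succ IH addn1.
have step i : periodic_orbit i < g (periodic_orbit i).
  rewrite ltNge; apply/negP => gi.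
  have : iter q g (periodic_orbit i) <= periodic_orbit i.
    elim: q => //= n IH; apply: le_trans gi; by rewrite (le_mono glt).
  by rewrite -it periodic_orbit_period; lra.
move=> i j ij; have [n ->] : exists n : nat, j = i + n.+1%:Z.
  by exists (`|j - i|.-1)%N; lia.
elim: n => [|n IH]; first by rewrite periodic_orbit_succ.
by apply: lt_trans IH _; rewrite -(addn1 n.+1) PoszD addrA periodic_orbit_succ.
Qed.

End PeriodicOrbit.

(** Once the lifts are normalised to translation numbers [1 / 2] and [m / 3], that of their
    composite is known only up to an integer [N], determined later in each case. *)
Lemma modular_action_lifts (R : realType) (phi : circle_action R) (m : int)
    (rho : R) :
  0 < m < 3 ->
  rotation_number (phi alpha) = to_circle (1 / 2) ->
  rotation_number (phi beta) = to_circle (m%:~R / 3) ->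
  rotation_number (phi (alpha * beta)%g) = to_circle rho ->
  exists a b : R -> R, [/\ is_homeo_lift a (phi alpha),
    is_homeo_lift b (phi beta),
    forall x, a (a x) = x + 1, forall x, b (b (b x)) = x + m%:~R &
    exists N : int, translation_number (fun x => a (b x)) = rho + N%:~R].
Proof.
move=> m03 /homeo_lift_of_rotation_number [a aP ar].
move=> /homeo_lift_of_rotation_number [b bP br].
move=> /homeo_lift_of_rotation_number [f fP fr].
exists a, b; split=> //.
- exact: (homeo_lift_order2 (p := 1) (circle_action_alpha2 phi) aP ar).
- exact: (homeo_lift_order3 (circle_action_beta3 phi) bP br).
have := homeo_lift_comp aP bP; rewrite -gmulfM => abP.
have [N abN] := homeo_lift_unique abP fP; exists N.
case: fP => _ flt f1 _; rewrite -fr -translation_numberD //.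
by congr translation_number; apply/funext.
Qed.

Lemma iter_bounds (R : realType) (F : R -> R) (c d : R) n x :
  (forall x, x + c < F x < x + d) ->
  x + n.+1%:R * c < iter n.+1 F x < x + n.+1%:R * d.
Proof.
move=> Fcd; elim: n => [|n IH]; first by rewrite !mul1r.
rewrite iterS; have := Fcd (iter n.+1 F x); move: IH.
by rewrite -(natr1 n.+1) !mulrDl !mul1r; lra.
Qed.

Lemma fuchsian_rotation_orbit (R : realType) (phi : circle_action R) :
  rotation_number (phi alpha) = to_circle (1 / 2) ->
  rotation_number (phi beta) = to_circle (1 / 3) ->
  rotation_number (phi (alpha * beta)%g) = to_circle 0 ->
  exists a b X, [/\ is_lift a (phi alpha), is_lift b (phi beta) &
    modular_orbit 0 0 1 a b X].
Proof.
move=> ra rb rab.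
have [a [b [aP bP aa bbb [N abN]]]] :=
  modular_action_lifts (m := 1) isT ra rb rab.
have [_ alt a1 al] := aP; have [_ blt b1 bl] := bP.
have [_ flt f1 _] := homeo_lift_comp aP bP.
have fc := homeo_lift_continuous (homeo_lift_comp aP bP).
have abound := sqrt_translation_bounds alt aa.
have bbound := cbrt_translation_bounds (m := 1) blt isT b1 bbb.
have [x0 fx0] : exists x, iter 1 (fun x => a (b x)) x = x + N%:~R.
  by apply: periodic_point => //; rewrite abN mul1r add0r.
(* Each of [a] and [b] moves points by strictly between 0 and 1, hence [0 < N < 2]. *)
have N1 : N = 1.
  have : 0 < (N%:~R : R) < 2.
    by have := abound (b x0); have := bbound x0; rewrite /= in fx0;
      rewrite fx0; lra.
  by rewrite ltr0z (ltr_int R N 2); lia.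
exists a, b, (fun i => x0 + i%:~R); split => //.
by apply: modular_orbit_fixed_point => //; rewrite N1 in fx0.
Qed.

Lemma five_fold_rotation_orbit (R : realType) (phi : circle_action R) :
  rotation_number (phi alpha) = to_circle (1 / 2) ->
  rotation_number (phi beta) = to_circle (2 / 3) ->
  rotation_number (phi (alpha * beta)%g) = to_circle (1 / 5) ->
  exists a b X, [/\ is_lift a (phi alpha), is_lift b (phi beta) &
    modular_orbit 2 3 2 a b X].
Proof.
move=> ra rb rab.
have [a [b [aP bP aa bbb [N abN]]]] :=
  modular_action_lifts (m := 2) isT ra rb rab.
have [_ alt a1 al] := aP; have [_ blt b1 bl] := bP.
have := homeo_lift_comp aP bP; set f := fun x => a (b x) => fP.
have [_ flt f1 _] := fP; have fc := homeo_lift_continuous fP.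
have abound := sqrt_translation_bounds alt aa.
have bbound := cbrt_translation_bounds (m := 2) blt isT b1 bbb.
have fbound x : x + 0 < f x < x + 2.
  by have := abound (b x); have := bbound x; rewrite /f; lra.
have [x0 fx0] : exists x, iter 5 f x = x + (1 + 5 * N)%:~R.
  by apply: periodic_point => //; rewrite abN intrD intrM; field.
(* Otherwise [b < a] everywhere, although six iterations of [b] add 4 and six of [a] add only 3. *)
have [y fy] : exists y, y + 1 <= f y.
  apply: contrapT => /forallNP nf.
  have ba x : b x < a x.
    rewrite -(leW_mono (le_mono alt)) aa ltNge; apply/negP.
    exact: nf.
  have it n x : iter n.+1 b x < iter n.+1 a x.
    elim: n => [|n IH]; first exact: ba.
    by apply: lt_trans (ba _) _; exact: alt.
  by have := it 5 0; rewrite /= !bbb !aa; lra.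
(* The bounds on [f] leave [N = 0] or 1. If [N = 0], five iterations of [f] add 1 at [x0] and at
   least 5 at [y], but displacements differ by at most 2. *)
have N1 : N = 1.
  have := iter_bounds 4 x0 fbound; rewrite fx0 mulr0 => N10.
  have : 0 < ((1 + 5 * N)%:~R : R) < 10%:~R by lra.
  rewrite ltr0z ltr_int => N02.
  have [N0|//] : N = 0 \/ N = 1 by lia.
  exfalso.
  have fle n := @iter_homo_le _ _ flt n; have itf1 n := @iter_commutes _ _ f1 n.
  have := iter_displacement flt f1 5 y; have := iter_displacement flt f1 5 x0.
  have : y + 5 <= iter 5 f y.
    have it n : y + n%:Z%:~R <= iter n f y.
      elim: n => [|n IH]; first by rewrite addr0.
      apply: le_trans (fle 1 _ _ IH); rewrite [iter 1 _ _]f1.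
      by rewrite -addn1 PoszD intrD mulr1z; move: fy; lra.
    exact: (it 5).
  by rewrite fx0 N0 mulr0 addr0 mulr1z !ler_norml; lra.
(* Subtracting 1 brings the translation number to [1 / 5], so that [g] moves its orbit by one index
   and [f] by [1 + 5 = 6]. *)
pose g x := f x + (-1)%:~R.
have gP : is_homeo_lift g _ := homeo_lift_shift (-1) fP.
have [_ glt g1 _] := gP.
have gf n x : iter n g x = iter n f x - n%:R.
  elim: n => [|n IH]; first by rewrite subr0.
  rewrite !iterS IH /g (_ : - n%:R = (- n%:Z)%:~R); last by rewrite intrN.
  by rewrite f1 !intrN -natr1; ring.
have g5 : iter 5 g x0 = x0 + 1 by rewrite gf fx0 N1; ring.
exists a, b, (periodic_orbit g 5 x0); split => //.
have X5 := periodic_orbit_period g1 g5.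
apply: modular_orbit_five => //; first exact: periodic_orbit_homo.
move=> i; rewrite (_ : i + 6 = i + 1 + 5) ?X5; last by lia.
by rewrite (periodic_orbit_succ g1 g5) /g intrN subrK.
Qed.

(** * The Fuchsian action *)

Section OnePointCompactification.
Variable R : realType.
Local Notation opc := (one_point_compactification R).

Definition mobius_alpha (p : opc) : opc :=
  match p with
  | None => Some 0
  | Some y => if y == 0 then None else Some (- y^-1)
  end.

Definition mobius_beta (p : opc) : opc :=
  match p with
  | None => Some (-1)
  | Some y => if y == 0 then None else Some (- (y + 1) / y)
  end.

Lemma mobius_word_alpha (p : opc) : mobius (word_mx [:: la]) p = mobius_alpha p.
Proof.
rewrite /mobius /word_mx big_seq1 /letter_mx /= !mxE /= mulr0z mulr1z mulrN1z.
case: p => [y|] /=; first by rewrite mul1r addr0 mul0r add0r mulN1r.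
by rewrite oner_eq0 mul0r.
Qed.

Lemma mobius_word_beta (p : opc) : mobius (word_mx [:: lb]) p = mobius_beta p.
Proof.
rewrite /mobius /word_mx big_seq1 /letter_mx /= !mxE /= mulr0z mulr1z mulrN1z.
case: p => [y|] /=; last by rewrite oppr_eq0 oner_eq0 invrN invr1 mul1r.
by rewrite mul1r mulN1r addr0 oppr_eq0 invrN mulrN mulNr.
Qed.

Lemma mobius_translation (y : R) :
  mobius_alpha (mobius_beta (mobius_beta (Some y))) = Some (y + 1).
Proof.
rewrite /=; have [->|y0] /= := eqVneq y 0.
  by rewrite oppr_eq0 oner_eq0 invrN invr1 opprK add0r.
rewrite mulf_eq0 invr_eq0 (negPf y0) orbF oppr_eq0.
have [->//|y1] /= := eqVneq (y + 1) 0.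
have -> : - (- (y + 1) / y + 1) / (- (y + 1) / y) = - (y + 1)^-1.
  by field; rewrite y0 y1.
by rewrite oppr_eq0 invr_eq0 (negPf y1) invrN invrK opprK.
Qed.

Lemma mobius_translationV (y : R) :
  mobius_beta (mobius_alpha (Some y)) = Some (y - 1).
Proof.
rewrite /=; have [->|y0] /= := eqVneq y 0; first by rewrite sub0r.
rewrite oppr_eq0 invr_eq0 (negPf y0); congr Some.
by field.
Qed.

(** Translation by 1 pushes any point to infinity, so [M] contains infinity, then its image 0 and
    all integers. Rationals follow by induction on the denominator, and density finishes. *)
Lemma mobius_invariant_closed (M : set opc) :
  closed M -> M !=set0 -> (forall p, M p -> M (mobius_alpha p)) ->
  (forall p, M p -> M (mobius_beta p)) -> forall p, M p.
Proof.
move=> Mc [p0 Mp0] Ma Mb.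
have MT (y : R) (n : int) : M (Some y) -> M (Some (y + n%:~R)).
  move=> My; elim/int_bi_ind: n => [|n]; first by rewrite addr0.
  rewrite intrD addrA; split=> [/Mb/Mb/Ma|/Ma/Mb].
    by rewrite mobius_translation.
  by rewrite mobius_translationV addrK.
have M0 : M None.
  case: p0 Mp0 => // x Mx; apply: contrapT => nM.
  have : nbhs (None : opc) (~` M).
    by apply: open_nbhs_nbhs; split=> //; exact: closed_openC.
  case=> C [Cc _] CM.
  have [B [_ /(_ _ (ltr_pwDr ltr01 (lexx B))) CB]] := compact_bounded Cc.
  have [n xn] : exists n : nat, B + 1 < x + n%:R.
    exists (Num.truncn (B + 1 - x)).+1.
    by have := truncnS_gt (B + 1 - x); lra.
  apply: (CM (Some (x + n%:R))); last exact: (MT x n).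
  left; exists (x + n%:R) => // Cn.
  have xB : `|x + n%:R| <= B + 1 := CB _ Cn.
  by have := ler_norm (x + n%:R); lra.
have Mint (n : int) : M (Some n%:~R).
  by rewrite -[n%:~R]add0r; apply: MT; exact: (Ma _ M0).
have Mrat d : forall n : int, M (Some (n%:~R / d.+1%:R)).
  elim/ltn_ind: d => d IH n.
  have dn0 : d.+1%:R != 0 :> R by rewrite pnatr_eq0.
  rewrite (divz_eq n d.+1) intrD intrM mulrDl mulfK // addrC.
  apply: MT.
  have := modz_ge0 n (isT : d.+1 != 0 :> int).
  have := ltz_pmod n (isT : 0 < d.+1 :> int).
  case: (n %% d.+1)%Z => // -[|r] rd _; first by rewrite mul0r; exact: (Mint 0).
  (* A proper fraction [r / d] is the image of [- d / r], of smaller denominator, under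
     [y |-> - 1 / y]. *)
  have := Ma _ (IH r _ (- d.+1%:Z)).
  rewrite /= mulf_eq0 invr_eq0 intrN oppr_eq0 (negPf dn0) pnatr_eq0 /=.
  by rewrite mulNr invrN opprK invf_div; apply; lia.
move=> [r|//]; apply: contrapT => nMr.
have [] := @dense_rat R (~` (Some @^-1` M)).
- by exists r.
- apply: closed_openC; apply: (@preimage_closed R opc Some M) => //.
  by move=> x _; exact: one_point_compactification_some_continuous.
- move=> _ [] /[swap] -[q _ <-]; apply; rewrite /= /ratr.
  have := Mrat (`|denq q|.-1)%N (numq q).
  rewrite prednK ?absz_gt0 ?denq_neq0 //.
  by rewrite pmulrn gez0_abs ?denq_ge0.
Qed.

End OnePointCompactification.

Lemma to_circle_representative (R : realType) (t : R) (u : circle R) :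
  exists2 x, t <= x < t + 1 & to_circle x = u.
Proof.
have [x <-] := to_circle_surj u.
exists (x + (- Num.floor (x - t))%:~R); last exact: to_circle_shift.
have := floor_le_tmp (x - t); have := floorD1_gt (x - t).
by rewrite intrN intrD; lra.
Qed.

Lemma to_circle_inj (R : realType) (t x y : R) :
  t <= x < t + 1 -> t <= y < t + 1 -> to_circle x = to_circle y -> x = y.
Proof.
move=> tx ty /to_circle_eqP [n xy]; suff n0 : n = 0 by rewrite xy n0 addr0.
have : (-1)%:~R < (n%:~R : R) < 1%:~R by rewrite intrN mulr1z; lra.
by rewrite !ltr_int; lia.
Qed.

Lemma homeo_lift_at (R : realType) (f : circle_homeo R) (t : R) :
  exists2 F, is_homeo_lift F f & t <= F t < t + 1.
Proof.
have fP := homeo_liftP f; set F := homeo_lift f in fP.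
exists (fun x => F x + (- Num.floor (F t - t))%:~R);
  first exact: homeo_lift_shift.
have := floor_le_tmp (F t - t); have := floorD1_gt (F t - t).
by rewrite intrN intrD; lra.
Qed.

(** In the quotient topology openness is tested on the preimage, and invariance makes the preimage
    of the image equal to [K]. *)
Lemma closed_shift_invariant_image (R : realType) (K : set R) :
  closed K -> (forall x (n : int), K x -> K (x + n%:~R)) ->
  closed (@to_circle R @` K).
Proof.
move=> Kc Kn; rewrite -openC.
rewrite (_ : open _ = open (@to_circle R @^-1` (~` (@to_circle R @` K)))) //.
rewrite (_ : _ @^-1` _ = ~` K); first exact: closed_openC.
apply/seteqP; split=> x /=; first by apply: contra_not => Kx; exists x.
by apply: contra_not => -[y Ky /esym/to_circle_eqP [n ->]]; exact: Kn.
Qed.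

Lemma fuchsian_lifts (R : realType) (phi : circle_action R) :
  fuchsian_action phi -> exists a b y, [/\ is_homeo_lift a (phi alpha),
    is_homeo_lift b (phi beta), modular_orbit 0 0 1 a b (fun i => y + i%:~R) &
    minimal_pair a b].
Proof.
move=> [theta [[eta [thetac etac thetaK etaK]] thetao] thetaE].
have thA u : theta (phi alpha u) = mobius_alpha (theta u).
  by rewrite thetaE mobius_word_alpha.
have thB u : theta (phi beta u) = mobius_beta (theta u).
  by rewrite thetaE mobius_word_beta.
pose th x := theta (to_circle x).
(* [t0], [t1], [t2] lie over infinity, -1 and 0, which [beta] permutes cyclically in this order,
   while [alpha] exchanges infinity and 0. Their order on the line determines the translations [a]
   squared and [b] cubed. *)
have [t0 _ t0E] := to_circle_representative 0 (eta None).
have [t1 t1b t1E] := to_circle_representative t0 (eta (Some (-1))).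
have [t2 t2b t2E] := to_circle_representative t0 (eta (Some 0)).
have {t0E} th0 : th t0 = None by rewrite /th t0E etaK.
have {t1E} th1 : th t1 = Some (-1) by rewrite /th t1E etaK.
have {t2E} th2 : th t2 = Some 0 by rewrite /th t2E etaK.
have thS x : th (x + 1) = th x by rewrite /th (to_circle_shift x 1).
have thI t x y : th x = th y -> t <= x < t + 1 -> t <= y < t + 1 -> x = y.
  by move=> /(can_inj thetaK) xy tx ty; exact: to_circle_inj tx ty xy.
have t01 : t0 < t1.
  case/andP: t1b; rewrite le_eqVlt => /predU1P[t01|//].
  by move: th1; rewrite -t01 th0.
have t02 : t0 < t2.
  case/andP: t2b; rewrite le_eqVlt => /predU1P[t02|//].
  by move: th2; rewrite -t02 th0.
have t12 : t1 < t2.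
  rewrite ltNge le_eqVlt; apply/negP => /predU1P[t12|t21].
    by have : th t1 = th t2 by [rewrite t12]; rewrite th1 th2 => -[]; lra.
  have := thetao t0 t2 t1 0 (-1) th0 t02 t21 _ th2 th1.
  by case/andP: t1b => _ t1b /(_ t1b); lra.
have [a aP at0] := homeo_lift_at (phi alpha) t0.
have [b bP bt0] := homeo_lift_at (phi beta) t0.
have [_ alt a1 al] := aP; have [_ blt b1 bl] := bP.
have tha x : th (a x) = mobius_alpha (th x) by rewrite /th -al thA.
have thb x : th (b x) = mobius_beta (th x) by rewrite /th -bl thB.
have incr (F : R -> R) (x y : R) :
    {homo F : x y / x < y} -> commutes_with_translations F ->
    x <= y < x + 1 -> F x <= F y < F x + 1.
  move=> Flt F1 /andP[xy yx]; have Fle := le_mono Flt.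
  by rewrite -(F1 x 1) Fle xy (leW_mono Fle).
have a0 : a t0 = t2.
  by apply: (thI t0) => //; rewrite tha th0 th2.
have a2 : a t2 = t0 + 1.
  apply: (thI t2); first by rewrite tha th2 /= eqxx thS th0.
    by have := incr a t0 t2 alt a1 t2b; rewrite a0.
  by move: t2b; lra.
have b0 : b t0 = t1.
  by apply: (thI t0) => //; rewrite thb th0 th1.
have b1' : b t1 = t2.
  apply: (thI t1).
  - by rewrite thb th1 /= oppr_eq0 oner_eq0 addNr oppr0 mul0r th2.
  - by have := incr b t0 t1 blt b1 t1b; rewrite b0.
  - by move: t2b; lra.
have b2 : b t2 = t0 + 1.
  apply: (thI t2); first by rewrite thb th2 /= eqxx thS th0.
    by have := incr b t1 t2 blt b1; rewrite b1'; apply; move: t2b; lra.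
  by move: t2b; lra.
have aa x : a (a x) = x + 1.
  have := homeo_lift_comp aP aP; rewrite circle_action_alpha2 =>
    /homeo_lift1 [N aN].
  by have := aN t0; rewrite a0 a2 aN => /addrI <-.
have bbb x : b (b (b x)) = x + 1.
  have := homeo_lift_comp (homeo_lift_comp bP bP) bP.
  rewrite circle_action_beta3 => /homeo_lift1 [N bN].
  by have := bN t0; rewrite b0 b1' b2 bN => /addrI <-.
(* [t2] lies over 0, the fixed point of the parabolic map [y |-> y / (y + 1)] given by
   [alpha * beta]. *)
exists a, b, t2; split=> //.
  by apply: modular_orbit_fixed_point => //; rewrite b2 (a1 t0 1) a0.
move=> K Kc [x0 Kx0] Ka Kb KV.
have Kn x (n : int) : K x -> K (x + n%:~R).
  move=> Kx; elim/int_bi_ind: n => [|n]; first by rewrite addr0.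
  rewrite intrD addrA -[1%:~R]/1; split=> [/Ka/Ka|/KV]; first by rewrite aa.
  by rewrite addrK.
(* The image of [K] is written as a preimage under the inverse [eta], so that it is closed by
   continuity. *)
pose M := eta @^-1` (@to_circle R @` K).
have MK x : M (th x) -> K x.
  by rewrite /M /th /= thetaK => -[y Ky /esym/to_circle_eqP [n ->]]; exact: Kn.
have KM x : K x -> M (th x) by move=> Kx; exists x; rewrite // /th thetaK.
have thsurj p : exists x, th x = p.
  have [x xp] := to_circle_surj (eta p); by exists x; rewrite /th xp etaK.
have Mall : forall p, M p.
  apply: mobius_invariant_closed.
  - apply: (@preimage_closed _ _ eta) => [p _|]; first exact: etac.
    exact: closed_shift_invariant_image.
  - by exists (th x0); exact: KM.
  - by move=> p; have [x <-] := thsurj p => /MK/Ka/KM; rewrite tha.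
  - by move=> p; have [x <-] := thsurj p => /MK/Kb/KM; rewrite thb.
by move=> x; apply: MK.
Qed.

(** * The 5-fold lift *)

Lemma to_circleMn (R : realType) (x : R) n :
  to_circle (x *+ n) = to_circle x *+ n.
Proof.
elim: n => [|n IH]; last by rewrite !mulrS to_circleD IH.
by rewrite !mulr0n; apply: (addrI (to_circle 0)); rewrite -to_circleD !addr0.
Qed.

(** The rescaled map [x |-> k F (x / k)] projects to the same circle map as [f]. The integer [j]
    records the deck translation by [j / k]. *)
Lemma fold_lift_homeo_lift (R : realType) (k : nat) (psi phi : circle_action R)
    (g : Gamma) (f F : R -> R) :
  (0 < k)%N -> fold_lift k psi phi ->
  is_homeo_lift f (psi g) -> is_homeo_lift F (phi g) ->
  exists j : int, forall x, F (x / k%:R) = (f x + j%:~R) / k%:R.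
Proof.
move=> k0 psiphi [_ flt f1 fl] [_ Flt F1 Fl].
have kR : 0 < k%:R :> R by rewrite ltr0n.
have kn0 := lt0r_neq0 kR.
have [||x||x|j Fj] := @lifts_differ_by_translation _
  (fun x => F (x / k%:R) *+ k) f k k0.
- by move=> x y xy; rewrite ltr_pMn2r //; apply: Flt;
    rewrite ltr_pM2r ?invr_gt0.
- exact: flt.
- by rewrite mulrDl divff // (F1 _ 1) mulrnDl.
- exact: f1.
- by rewrite to_circleMn -Fl psiphi -to_circleMn -(mulr_natr (_ / _)) divfK.
- by exists j => x; rewrite -Fj -(mulr_natr (F _)) mulfK.
Qed.

(** [L x n] says that [K] meets the fibre over [x] in sheet [n]. Minimality downstairs puts [y] in
    some sheet; [A B] fixes the fibre of [y] and permutes its sheets cyclically, so [y] is in all of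
    them, and minimality applies to the intersection of the sheets. *)
Lemma fold_lift_minimal (R : realType) (a b A B : R -> R) (y : R) :
  modular_orbit 0 0 1 a b (fun i => y + i%:~R) ->
  modular_orbit 2 3 2 A B (fun i => (y + i%:~R) / 5) ->
  (forall x, A (x / 5) = (a x + 2) / 5) ->
  (forall x, B (x / 5) = (b x + 3) / 5) ->
  minimal_pair a b -> minimal_pair A B.
Proof.
move=> oa oA AE BE abmin K Kc [z0 Kz0] KA KB KV.
have a1 := mo_a_shift oa; have b1 := mo_b_shift oa.
have K1 x : K x -> K (x + 1) by move=> /KA/KA; rewrite (mo_aa oA).
have Kn x (n : int) : K x -> K (x + n%:~R).
  move=> Kx; elim/int_bi_ind: n => [|n]; first by rewrite addr0.
  rewrite intrD addrA -[1%:~R]/1; split=> [|/KV]; first exact: K1.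
  by rewrite addrK.
pose L (x : R) (n : int) := K ((x + n%:~R) / 5).
have L5 (x : R) n : L x (n + 5) <-> L x n.
  rewrite /L intrD (addrA x) mulrDl divff //.
  by split=> [/KV|]; [rewrite addrK|exact: K1].
have La (x : R) n : L x n -> L (a x) (n + 2).
  by move/KA; rewrite AE a1 /L intrD (addrA (a x)).
have Lb (x : R) n : L x n -> L (b x) (n + 3).
  by move/KB; rewrite BE b1 /L intrD (addrA (b x)).
have LV (x : R) n : L x n -> L (x - 1) (n + 1).
  by rewrite /L intrD addrACA addNr addr0.
have Lc n : closed [set x | L x n].
  apply: (@preimage_closed _ _ (fun x : R => (x + n%:~R) / 5)) => // x _.
  by apply: cvgM; [apply: cvgD; [exact: cvg_id|exact: cvg_cst]|exact: cvg_cst].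
(* Sheets have period 5, so a finite union suffices and is closed. *)
pose U : set R := \bigcup_(r in `I_5) [set x | L x r].
have UP x : U x <-> exists n, L x n.
  split=> [[r _ Lr]|[n]]; first by exists r.
  have Lq q r : L x (q * 5 + r) <-> L x r.
    elim/int_bi_ind: q => [|q]; first by rewrite mul0r add0r.
    by rewrite mulrDl mul1r addrAC L5.
  rewrite (divz_eq n 5) Lq; have := modz_ge0 n (isT : 5 != 0 :> int).
  have := ltz_pmod n (isT : 0 < 5 :> int); case: (n %% 5)%Z => // r r5 _ Lr.
  by exists r.
have [n Ln] : exists n, L y n.
  apply/UP; apply: (abmin U).
  - by apply: closed_bigcup => // r _; exact: Lc.
  - by exists (z0 * 5); apply: (UP _).2; exists 0; rewrite /L addr0 mulfK.
  - by move=> x /(UP _).1 [n /La Ln]; apply: (UP _).2; eexists; exact: Ln.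
  - by move=> x /(UP _).1 [n /Lb Ln]; apply: (UP _).2; eexists; exact: Ln.
  - by move=> x /(UP _).1 [n /LV Ln]; apply: (UP _).2; eexists; exact: Ln.
have aby : a (b y) = y + 1 by have := mo_ab oa 0; rewrite !addr0 add0r.
(* The sheet moves by 3, 2 and 1 under [B], [A] and relabelling after [x - 1]: 6 in total, which is
   1 modulo 5. *)
have LS m : L y m -> L y (m + 1).
  move/Lb/La/LV; rewrite aby addrK (_ : m + 3 + 2 + 1 = m + 1 + 5) ?L5 //.
  by lia.
have Ly m : L y m.
  rewrite -(subrK n m) addrC; elim/int_bi_ind: (m - n) => [|k];
    first by rewrite addr0.
  rewrite addrA; split=> [|/LS/LS/LS/LS]; first exact: LS.
  by rewrite (_ : n + k + 1 + 1 + 1 + 1 + 1 = n + k + 5) ?L5 //; lia.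
move=> x; have := abmin (\bigcap_n [set x | L x n]) _ _ _ _ _ (x * 5) 0 I.
rewrite /L /= addr0 mulfK //; apply.
- by apply: closed_bigI => m _; exact: Lc.
- by exists y => m _; exact: Ly.
- by move=> z Lz m _; rewrite -(subrK 2 m); apply: La; exact: Lz.
- by move=> z Lz m _; rewrite -(subrK 3 m); apply: Lb; exact: Lz.
- by move=> z Lz m _; rewrite -(subrK 1 m); apply: LV; exact: Lz.
Qed.

Lemma five_fold_lifts (R : realType) (psi phi : circle_action R) :
  fuchsian_action psi -> fold_lift 5 psi phi ->
  exists A B Y, [/\ is_homeo_lift A (phi alpha), is_homeo_lift B (phi beta),
    modular_orbit 2 3 2 A B Y & minimal_pair A B].
Proof.
move=> /fuchsian_lifts [a [b [y [aP bP oa abmin]]]] psiphi.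
have a1 := mo_a_shift oa; have b1 := mo_b_shift oa.
have aa := mo_aa oa; have bbb := mo_bbb oa.
have aby : a (b y) = y + 1 by have := mo_ab oa 0; rewrite !addr0 add0r.
have [A AP AE] : exists2 A, is_homeo_lift A (phi alpha) &
    forall x, A (x / 5) = (a x + 2) / 5.
  have A0P := homeo_liftP (phi alpha); set A0 := homeo_lift _ in A0P.
  have [j Aj] := fold_lift_homeo_lift (k := 5) isT psiphi aP A0P.
  have := homeo_lift_comp A0P A0P; rewrite circle_action_alpha2.
  move=> /homeo_lift1 [N AN].
  (* Order 2 gives [2 j = -1] modulo 5, so [j = 2] modulo 5, and the correction [3 N - j - 1] equals
     [(j - 2) / 5]. *)
  have jN : 1 + 2 * j = 5 * N.
    apply/eqP; rewrite -(eqr_int R) !intrD !intrM; apply/eqP.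
    by have := AN (0 / 5); rewrite Aj Aj a1 aa; lra.
  exists (fun x => A0 x + (- (3 * N - j - 1))%:~R);
    first exact: homeo_lift_shift.
  move=> x; rewrite Aj; apply: (canRL (mulfK _)) => //.
  rewrite mulrDl divfK // -addrA; congr (_ + _).
  rewrite -[5]/(5%:~R) -[2]/(2%:~R) -intrM -intrD; congr _%:~R; lia.
have [B BP BE] : exists2 B, is_homeo_lift B (phi beta) &
    forall x, B (x / 5) = (b x + 3) / 5.
  have B0P := homeo_liftP (phi beta); set B0 := homeo_lift _ in B0P.
  have [j Bj] := fold_lift_homeo_lift (k := 5) isT psiphi bP B0P.
  have := homeo_lift_comp (homeo_lift_comp B0P B0P) B0P.
  rewrite circle_action_beta3 => /homeo_lift1 [N BN].
  (* Order 3 likewise gives [j = 3] modulo 5, with [2 N - j - 1 = (j - 3) / 5]. *)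
  have jN : 1 + 3 * j = 5 * N.
    apply/eqP; rewrite -(eqr_int R) !intrD !intrM; apply/eqP.
    by have := BN (0 / 5); rewrite Bj Bj Bj !b1 bbb; lra.
  exists (fun x => B0 x + (- (2 * N - j - 1))%:~R);
    first exact: homeo_lift_shift.
  move=> x; rewrite Bj; apply: (canRL (mulfK _)) => //.
  rewrite mulrDl divfK // -addrA; congr (_ + _).
  rewrite -[5]/(5%:~R) -[3]/(3%:~R) -intrM -intrD; congr _%:~R; lia.
have div5 (x : R) : x = x * 5 / 5 by rewrite mulfK.
have oA : modular_orbit 2 3 2 A B (fun i => (y + i%:~R) / 5).
  have [_ Alt A1 _] := AP; have [_ Blt B1 _] := BP.
  apply: modular_orbit_five => //.
  - by move=> x; rewrite (div5 x) !AE (a1 _ 2) aa; lra.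
  - by move=> x; rewrite (div5 x) !BE !(b1 _ 3) bbb; lra.
  - by move=> i j ij; rewrite ltr_pM2r ?invr_gt0 // ltrD2l ltr_int.
  - by move=> i; rewrite intrD; lra.
  - by move=> i; rewrite BE AE b1 (a1 _ 3) a1 aby intrD; lra.
exists A, B, (fun i => (y + i%:~R) / 5); split=> //.
exact: fold_lift_minimal oa oA AE BE abmin.
Qed.

Theorem theorem1p1 (R : realType) (phi phiO : circle_action R)
    (hO : fuchsian_action phiO) :
  ((rotation_number (phi alpha), rotation_number (phi beta),
    rotation_number (phi (alpha * beta)%g)) =
     (to_circle (1 / 2), to_circle (1 / 3), to_circle 0) ->
   in_semi_conjugacy_class phiO phi) /\
  (forall phi5 : circle_action R, fold_lift 5 phiO phi5 ->
   (rotation_number (phi alpha), rotation_number (phi beta),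
    rotation_number (phi (alpha * beta)%g)) =
     (to_circle (1 / 2), to_circle (2 / 3), to_circle (1 / 5)) ->
   in_semi_conjugacy_class phi5 phi).
Proof.
(* The constructed map goes from [phi] to the model action, hence the use of symmetry. *)
split=> [[ra rb rab]|phi5 h5 [ra rb rab]];
  apply: Relation_Operators.rst_sym; apply: Relation_Operators.rst_step.
  have [a [b [X [al bl oX]]]] := fuchsian_rotation_orbit ra rb rab.
  have [A [B [y [AP BP oY ABmin]]]] := fuchsian_lifts hO.
  have [[_ _ _ Al] [_ _ _ Bl]] := (AP, BP).
  apply: (modular_orbit_semi_conjugate _ al bl Al Bl oX oY) => //.
  - exact: homeo_lift_continuous AP.
  - exact: homeo_lift_continuous BP.
have [a [b [X [al bl oX]]]] := five_fold_rotation_orbit ra rb rab.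
have [A [B [Y [AP BP oY ABmin]]]] := five_fold_lifts hO h5.
have [[_ _ _ Al] [_ _ _ Bl]] := (AP, BP).
apply: (modular_orbit_semi_conjugate _ al bl Al Bl oX oY) => //.
- exact: homeo_lift_continuous AP.
- exact: homeo_lift_continuous BP.
Qed.
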